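(* Let $A$ be a unital locally $C^{\ast}$-algebra. Then $A$ is an annihilator algebra if and only if $A$ is topologically ${}^{\ast}$-isomorphic to the Cartesian product (with product topology) of a family of full matrix algebras $M_{n_\nu}(\mathbb{C})$.
   Context: A locally $C^{\ast}$-algebra is a complete Hausdorff locally convex ${}^{\ast}$-algebra over $\mathbb{C}$ with jointly continuous multiplication whose topology is given by a family of $C^{\ast}$-seminorms. $A$ is an annihilator algebra if for every closed left ideal $J$ and closed right ideal $K$: $\mathrm{ran}(J)=0\iff J=A$ and $\mathrm{lan}(K)=0\iff K=A$, where $\mathrm{lan}(S)=\{a:aS=0\}$, $\mathrm{ran}(S)=\{a:Sa=0\}$. (For locally $C^{\ast}$-algebras this is equivalent to: all irreducible Hermitian $A$-modules are projective; $\mathrm{Soc}(A)$ is dense; $A$ is dual; etc.) *)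

(* Defs.v *)
From HB Require Import structures.
From mathcomp Require Import all_boot all_algebra.
From mathcomp Require Import complex.
From mathcomp Require Import boolp classical_sets filter reals.
From Stdlib Require List.

Set Implicit Arguments.
Unset Strict Implicit.
Unset Printing Implicit Defensive.

Import GRing.Theory Num.Theory.
Local Open Scope ring_scope.
Local Open Scope classical_set_scope.

Definition absC (R : rcfType) (z : R[i]) : R := ComplexField.Normc.normc z.

Section LocallyCstar.
Variables (R : realType) (A : algType R[i]) (L : Type).
Variables (star : A -> A) (p : L -> A -> R).

Definition is_star_involution : Prop :=
  [/\ forall x y : A, star (x + y) = star x + star y,
      forall (c : R[i]) (x : A), star (c *: x) = conjc c *: star x,
      forall x y : A, star (x * y) = star y * star x &
      forall x : A, star (star x) = x].

Definition is_Cstar_seminorm (q : A -> R) : Prop :=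
  [/\ forall x, 0 <= q x,
      forall x y, q (x + y) <= q x + q y,
      forall (c : R[i]) x, q (c *: x) = absC c * q x,
      forall x y, q (x * y) <= q x * q y &
      forall x, q (star x * x) = q x ^+ 2].

(* basic neighbourhoods of the locally convex topology defined by the family p:
   y is (F,d)-close to x for a finite set F of seminorm indices *)
Definition sn_close (F : seq L) (d : R) (x y : A) : Prop :=
  forall l, List.In l F -> p l (x - y) < d.

Definition sn_separated : Prop := forall x : A, (forall l, p l x = 0) -> x = 0.

Definition sn_cauchy (F : set_system A) : Prop :=
  forall l (e : R), 0 < e -> exists S, F S /\ forall x y, S x -> S y -> p l (x - y) < e.

Definition sn_converges (F : set_system A) (a : A) : Prop :=
  forall l (e : R), 0 < e -> F [set x | p l (x - a) < e].

Definition sn_complete : Prop :=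
  forall F : set_system A, ProperFilter F -> sn_cauchy F -> exists a, sn_converges F a.

Definition sn_mul_jointly_continuous : Prop :=
  forall (x0 y0 : A) (G : seq L) (e : R), 0 < e ->
    exists (F : seq L) (d : R), 0 < d /\
      forall x y, sn_close F d x0 x -> sn_close F d y0 y ->
        sn_close G e (x0 * y0) (x * y).

Definition locally_Cstar_algebra : Prop :=
  [/\ is_star_involution,
      forall l, is_Cstar_seminorm (p l),
      sn_separated,
      sn_complete &
      sn_mul_jointly_continuous].

Definition sn_closed (S : set A) : Prop :=
  forall x, (forall (F : seq L) (d : R), 0 < d -> exists s, S s /\ sn_close F d x s) -> S x.

Definition left_ideal (J : set A) : Prop :=
  [/\ J 0, forall x y, J x -> J y -> J (x + y),
      forall (c : R[i]) x, J x -> J (c *: x) &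
      forall a x, J x -> J (a * x)].

Definition right_ideal (K : set A) : Prop :=
  [/\ K 0, forall x y, K x -> K y -> K (x + y),
      forall (c : R[i]) x, K x -> K (c *: x) &
      forall a x, K x -> K (x * a)].

Definition lan (S : set A) : set A := [set a | forall s, S s -> a * s = 0].
Definition ran (S : set A) : set A := [set a | forall s, S s -> s * a = 0].

Definition annihilator_algebra : Prop :=
  (forall J, left_ideal J -> sn_closed J -> (ran J = [set 0] <-> J = setT)) /\
  (forall K, right_ideal K -> sn_closed K -> (lan K = [set 0] <-> K = setT)).

Variables (I : Type) (n : I -> nat).

Definition mxprod := forall v : I, 'M[R[i]]_(n v).

(* basic neighbourhoods of the product topology (each factor carries its
   finite-dimensional norm topology, here via the max-entry norm) *)
Definition prod_close (G : seq I) (d : R) (a b : mxprod) : Prop :=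
  forall v, List.In v G -> forall j k, absC (a v j k - b v j k) < d.

Definition mx_adj m (M : 'M[R[i]]_m) : 'M[R[i]]_m := (map_mx conjc M)^T.

Definition is_star_hom (phi : A -> mxprod) : Prop :=
  [/\ forall x y v, phi (x + y) v = phi x v + phi y v,
      forall (c : R[i]) x v, phi (c *: x) v = c *: phi x v,
      forall x y v, phi (x * y) v = phi x v *m phi y v,
      forall v, phi 1 v = 1%:M &
      forall x v, phi (star x) v = mx_adj (phi x v)].

Definition sn_to_prod_continuous (phi : A -> mxprod) : Prop :=
  forall (x : A) (G : seq I) (e : R), 0 < e ->
    exists (F : seq L) (d : R), 0 < d /\
      forall y, sn_close F d x y -> prod_close G e (phi x) (phi y).

Definition prod_to_sn_continuous (psi : mxprod -> A) : Prop :=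
  forall (a : mxprod) (F : seq L) (e : R), 0 < e ->
    exists (G : seq I) (d : R), 0 < d /\
      forall b, prod_close G d a b -> sn_close F e (psi a) (psi b).

Definition topological_star_iso (phi : A -> mxprod) : Prop :=
  is_star_hom phi /\ sn_to_prod_continuous phi /\
  exists psi : mxprod -> A,
    [/\ cancel phi psi, cancel psi phi & prod_to_sn_continuous psi].

End LocallyCstar.

(* Main.v *)
(* An annihilator algebra makes J + {x | x J^* = 0} dense for every left ideal J, and the projection
   of this sum onto J is contractive for each C*-seminorm; completeness then shows that every
   closed left ideal is A e for a self-adjoint idempotent e.  Applied to the kernel of p l this
   gives a central projection z with p l a norm on A z, and an infinite decreasing chain of
   projections below z is excluded, so z is a finite orthogonal sum of minimal central projections
   w, and each w is a finite orthogonal sum of minimal projections e.  For such an e, every nonzero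
   x in e A e has A x dense in A e; since p l ((1 - y^2) y^(2n)) tends to 0 for self-adjoint y of
   norm 1, a self-adjoint y in e A e with p l y = 1 satisfies y^2 = e, hence e A e = C e.  Matrix
   units then identify A w with a full matrix algebra, and completeness identifies A with the
   product over all w.
   Conversely, in a product of matrix algebras a closed left ideal without right annihilator maps
   onto each factor, hence is dense. *)
Require Import Defs.
From HB Require Import structures.
From mathcomp Require Import all_boot all_order all_algebra.
From mathcomp Require Import complex ring lra.
From mathcomp Require Import boolp classical_sets filter reals.
Import Order.TTheory GRing.Theory Num.Theory.
Set Implicit Arguments.
Unset Strict Implicit.
Unset Printing Implicit Defensive.
Local Open Scope ring_scope.
Local Open Scope complex_scope.
Local Open Scope classical_set_scope.

(** * C*-seminorms *)

Lemma absC_ge0 (R : rcfType) (z : R[i]) : 0 <= absC z.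
Proof. by case: z => a b; exact: sqrtr_ge0. Qed.

Lemma absC_real (R : rcfType) (t : R) : absC (t%:C) = `|t|.
Proof. by rewrite /absC /= expr0n /= addr0 sqrtr_sqr. Qed.

Section CstarSeminorm.
Variables (R : realType) (A : algType R[i]) (star : A -> A) (q : A -> R).
Hypothesis hstar : is_star_involution star.
Hypothesis hq : is_Cstar_seminorm star q.

Lemma starD x y : star (x + y) = star x + star y.
Proof. by case: hstar. Qed.
Lemma starZ c x : star (c *: x) = conjc c *: star x.
Proof. by case: hstar. Qed.
Lemma starM x y : star (x * y) = star y * star x.
Proof. by case: hstar. Qed.
Lemma starK x : star (star x) = x.
Proof. by case: hstar. Qed.
Lemma star0 : star 0 = 0.
Proof. by apply: (addrI (star 0)); rewrite -starD !addr0. Qed.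
Lemma starN x : star (- x) = - star x.
Proof. by apply: (addrI (star x)); rewrite -starD !subrr star0. Qed.
Lemma starB x y : star (x - y) = star x - star y.
Proof. by rewrite starD starN. Qed.
Lemma star1 : star 1 = 1.
Proof. by rewrite -[LHS]mul1r -{1}[1]starK -starM mul1r starK. Qed.
Lemma starX x n : star (x ^+ n) = star x ^+ n.
Proof. by elim: n => [|n IH]; rewrite ?expr0 ?star1 // exprS starM IH exprSr. Qed.
Lemma starZr (t : R) x : star (t%:C *: x) = t%:C *: star x.
Proof. by rewrite starZ conjc_real. Qed.
Lemma star_sum (I : Type) (r : seq I) P (F : I -> A) :
  star (\sum_(i <- r | P i) F i) = \sum_(i <- r | P i) star (F i).
Proof. exact: (big_morph _ starD star0). Qed.

Lemma sn_ge0 x : 0 <= q x. Proof. by case: hq. Qed.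
Lemma snD x y : q (x + y) <= q x + q y. Proof. by case: hq. Qed.
Lemma snZ c x : q (c *: x) = absC c * q x. Proof. by case: hq. Qed.
Lemma snM x y : q (x * y) <= q x * q y. Proof. by case: hq. Qed.
Lemma snC x : q (star x * x) = q x ^+ 2. Proof. by case: hq. Qed.
Lemma sn0 : q 0 = 0.
Proof. by rewrite -(scale0r 0) snZ -[0]/(0%:C) absC_real normr0 mul0r. Qed.
Lemma snZr (t : R) x : q (t%:C *: x) = `|t| * q x.
Proof. by rewrite snZ absC_real. Qed.
Lemma snN x : q (- x) = q x.
Proof. by rewrite -scaleN1r -[1]/(1%:C) -rmorphN snZr normrN1 mul1r. Qed.
Lemma snB x y : q (x - y) <= q x + q y.
Proof. by rewrite -(snN y) snD. Qed.
Lemma sn_sym x y : q (x - y) = q (y - x).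
Proof. by rewrite -snN opprB. Qed.
Lemma sn_tri y x z : q (x - z) <= q (x - y) + q (y - z).
Proof. by rewrite -(subrKA y) snD. Qed.
Lemma snMn x n : q (x *+ n) = q x *+ n.
Proof.
rewrite -scaler_nat -(rmorph_nat (real_complex R)) snZr ger0_norm ?ler0n //.
by rewrite mulr_natl.
Qed.

(** The C*-identity gives q y ^ 2 <= q (star y) * q y, where one factor [q y] cancels; taking [y] to
    be [x] and then [star x] gives both inequalities. *)
Lemma sn_star x : q (star x) = q x.
Proof.
suff le y : q y <= q (star y) by apply/eqP; rewrite eq_le le -{2}[x]starK le.
have [->|y0] := eqVneq (q y) 0; first exact: sn_ge0.
have y_gt0 : 0 < q y by rewrite lt_def y0 sn_ge0.
by rewrite -(ler_pM2r y_gt0) -expr2 -snC snM.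
Qed.

Lemma snC' x : q (x * star x) = q x ^+ 2.
Proof. by rewrite -{1}[x]starK snC sn_star. Qed.

Lemma sn_sa_sqr x : star x = x -> q (x ^+ 2) = q x ^+ 2.
Proof. by move=> sx; rewrite -snC sx expr2. Qed.

Lemma sn_proj e : star e = e -> e * e = e -> q e = 0 \/ q e = 1.
Proof.
move=> se ee; have := snC e; rewrite se ee => /eqP.
rewrite -subr_eq0 expr2 -{1}[q e]mulr1 -mulrBr mulf_eq0 subr_eq0.
by move=> /orP[]/eqP; [left|right].
Qed.

Lemma sn_proj_le1 e : star e = e -> e * e = e -> q e <= 1.
Proof. by move=> se ee; have [->|->] := sn_proj se ee. Qed.

Lemma sn1_le1 : q 1 <= 1.
Proof. by apply: sn_proj_le1; rewrite ?star1 ?mulr1. Qed.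

Lemma sn_sa_exp2 x n : star x = x -> q (x ^+ (2 ^ n)) = q x ^+ (2 ^ n).
Proof.
move=> sx; elim: n => [|n IH]; first by rewrite !expr1.
by rewrite expnSr !exprM sn_sa_sqr ?IH // starX sx.
Qed.

Lemma snX_le1 x n : q x <= 1 -> q (x ^+ n) <= 1.
Proof.
move=> x1; elim: n => [|n IH]; first exact: sn1_le1.
rewrite exprS (le_trans (snM _ _)) // mulr_ile1 ?sn_ge0 //.
Qed.

(** The seminorm commutes with the powers [2 ^ n] of a self-adjoint element, and [x ^+ n] divides
    [x ^+ (2 ^ n)] with a contractive cofactor. *)
Lemma snX_eq1 x n : star x = x -> q x = 1 -> q (x ^+ n) = 1.
Proof.
move=> sx x1; apply/eqP; rewrite eq_le snX_le1 ?x1 //=.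
have n2 : (n <= 2 ^ n)%N by rewrite ltnW // ltn_expl.
have : q (x ^+ (2 ^ n)) = 1 by rewrite sn_sa_exp2 // x1 expr1n.
rewrite -(subnK n2) exprD => <-.
rewrite (le_trans (snM _ _)) // ler_piMl ?sn_ge0 //.
by apply: snX_le1; rewrite x1.
Qed.

Lemma sn_sum (I : Type) (r : seq I) P (F : I -> A) :
  q (\sum_(i <- r | P i) F i) <= \sum_(i <- r | P i) q (F i).
Proof.
apply: (big_ind2 (fun x y => q x <= y)); rewrite ?sn0 // => x1 x2 y1 y2 h1 h2.
by rewrite (le_trans (snD _ _)) // lerD.
Qed.

End CstarSeminorm.

Lemma le_eps (R : realFieldType) (x y c : R) : 0 <= c ->
  (forall e : R, 0 < e -> x <= y + c * e) -> x <= y.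
Proof.
move=> c0 h; apply/ler_addgt0Pr => e e0.
have c1 : 0 < c + 1 by rewrite ltr_wpDl.
apply: le_trans (h (e / (c + 1)) (divr_gt0 e0 c1)) _.
rewrite lerD2l mulrA ler_pdivrMr // mulrC ler_pM2l //.
by rewrite lerDl.
Qed.

(** * Norm estimates in commutative algebras with a C*-seminorm *)

Section Commutative.
Variables (R : realType) (B : comAlgType R[i]) (star : B -> B) (q : B -> R).
Hypothesis hstar : is_star_involution star.
Hypothesis hq : is_Cstar_seminorm star q.

(** Takes the place of monotonicity of the norm on positive elements. For z = x + i y commutativity
    gives star z * z = x^2 + y^2, and x is the mean of z and [star z]. *)
Lemma sn_sqr_le x y : star x = x -> star y = y ->
  q x ^+ 2 <= q (x ^+ 2 + y ^+ 2).
Proof.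
move=> sx sy; pose j : B := ('i%C : R[i])%:A.
have jj : j * j = -1 by rewrite /j -scalerAl mul1r scalerA -expr2 sqr_i scaleN1r.
have sj : star j = - j.
  rewrite /j (starZ hstar) (star1 hstar) -scaleNr; congr (_ *: _).
  by apply/eqP; rewrite eq_complex /= oppr0 !eqxx.
pose z := x + j * y.
have sz : star z = x - j * y.
  by rewrite /z (starD hstar) (starM hstar) sx sy sj mulrN mulrC.
have szz : star z * z = x ^+ 2 + y ^+ 2.
  rewrite sz /z.
  have -> : (x - j * y) * (x + j * y) = x ^+ 2 - (j * j) * y ^+ 2 by ring.
  by rewrite jj mulN1r opprK.
have xz : x *+ 2 = z + star z by rewrite sz /z; ring.
rewrite -szz (snC hq) ler_sqr ?nnegrE ?(sn_ge0 hq) //.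
rewrite -(@ler_pMn2r _ 2) // -(snMn hq) xz (le_trans (snD hq _ _)) //.
by rewrite (sn_star hstar hq) -mulr2n.
Qed.

(* Successive approximations for b = (k + b^2) / 2, whose solution is 1 - sqrt (1 - k). *)
Lemma sn_sqrt k (e : R) : star k = k -> q k <= 1 -> 0 < e ->
  exists s, star s = s /\ q (s ^+ 2 - (1 - k)) <= e.
Proof.
move=> sk k1 e0.
wlog e1 : e e0 / e < 1.
  move=> wl; have [||s [ss se]] := wl (Num.min e (1 / 2)).
  - by rewrite lt_min e0 divr_gt0.
  - by rewrite gt_min; apply/orP; right; lra.
  by exists s; split=> //; rewrite (le_trans se) // ge_min lexx.
pose d : R := e / 2.
have [d0 d1] : 0 < d /\ d < 1 by rewrite /d; lra.
pose h : R[i] := (2^-1)%:C.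
(* Damping [k] by 1 - d^2 makes the ball of radius 1 - d invariant, as ((1 - d^2) + (1 - d)^2) / 2 =
   1 - d; on that ball [f] contracts by the factor 1 - d. *)
pose f b := h *: ((1 - d ^+ 2)%:C *: k + b ^+ 2).
pose b n := iter n f 0.
have fE x : f x *+ 2 = (1 - d ^+ 2)%:C *: k + x ^+ 2.
  rewrite /f -scaler_nat scalerA /h -(rmorph_nat (real_complex R)) -rmorphM.
  by rewrite mulfV ?pnatr_eq0 // scale1r.
have qf x : q (f x) = q (f x *+ 2) / 2.
  by rewrite (snMn hq (f x) 2) -[q (f x) *+ 2]mulr_natr mulfK ?pnatr_eq0.
have d2 : 0 <= 1 - d ^+ 2 by nra.
have sb n : star (b n) = b n.
  elim: n => [|n IH]; first exact: star0 hstar.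
  rewrite /= /f (starZr hstar) (starD hstar) (starZr hstar) sk (starX hstar).
  by rewrite -/(b n) IH.
have qb n : q (b n) <= 1 - d.
  elim: n => [|n IH]; first by rewrite (sn0 hq); lra.
  rewrite /= qf fE ler_pdivrMr //.
  apply: le_trans (snD hq _ _) _.
  rewrite (snZr hq) ger0_norm // (sn_sa_sqr hq (sb n)).
  have := sn_ge0 hq (iter n f 0); have := sn_ge0 hq k; move: IH; rewrite /b; nra.
have bS i : (b i.+2 - b i.+1) *+ 2 = (b i.+1 - b i) * (b i.+1 + b i).
  by rewrite mulrnBl /= !fE; ring.
have diff i : q (b i.+1 - b i) <= (1 - d) ^+ i.
  elim: i => [|j IH].
    rewrite subr0 expr0 (le_trans (qb 1%N)) //; lra.
  rewrite -(@ler_pMn2r _ 2) // -(snMn hq) bS (le_trans (snM hq _ _)) //.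
  rewrite exprSr -mulrnAr ler_pM ?(sn_ge0 hq) //.
  by rewrite (le_trans (snD hq _ _)) // mulr2n lerD.
have [n hn] : exists i, (1 - d) ^+ i <= d / 4.
  have [N hN] : exists N, 4 / (d * d) <= N%:R.
    by exists (Num.truncn (4 / (d * d))).+1; apply/ltW/truncnS_gt.
  (* A Bernoulli-type bound; since N d >= 4 / d, it yields (1 - d)^N <= d / 4. *)
  exists N; have hb : forall i, (1 - d) ^+ i * (1 + i%:R * d) <= 1.
    elim=> [|i IH]; first by rewrite expr0 mul0r addr0 mulr1.
    apply: le_trans IH; rewrite exprS -natr1 mulrAC mulrC.
    apply: ler_wpM2l; first by apply: exprn_ge0; lra.
    have := ler0n R i; nra.
  have hd : 4 <= N%:R * d * d.
    have dd : 0 < d * d by rewrite mulr_gt0.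
    by move: hN; rewrite ler_pdivrMr // mulrA.
  have hx : 0 <= (1 - d) ^+ N by apply: exprn_ge0; lra.
  have := hb N; nra.
exists (1 - b n); split; first by rewrite (starB hstar) (star1 hstar) sb.
have -> : (1 - b n) ^+ 2 - (1 - k) = (b n.+1 - b n) *+ 2 + (d ^+ 2)%:C *: k.
  rewrite mulrnBl /= fE rmorphB rmorph1 scalerBl scale1r; ring.
apply: le_trans (snD hq _ _) _.
rewrite (snMn hq) (snZr hq) ger0_norm ?sqr_ge0 // -mulr_natr.
have := diff n; have := sn_ge0 hq k; have : d *+ 2 = e by rewrite /d; lra.
nra.
Qed.

(** Induction on [m], replacing [y] by x = y^2. With n = 2^m - 1, u^2 = (1 - x) x^(2n+1) and v = (1
    - x) x^n, one has 2 u^2 + v^2 = (1 - x^2) x^(2n), so each step halves the bound. The root of 1 -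
    x needed for [u] is only approximate, whence the error [r]. *)
Lemma sn_decay y m : star y = y -> q y <= 1 ->
  q ((1 - y ^+ 2) * (y ^+ 2) ^+ (2 ^ m - 1)) <= 2 / 2 ^+ m.
Proof.
elim: m y => [|m IH] y sy y1.
  rewrite subnn !expr0 mulr1 divr1 (le_trans (snB hq _ _)) //.
  rewrite -[2]/(1 + 1) lerD ?(sn1_le1 hstar hq) //.
  by rewrite (sn_sa_sqr hq) // expr_le1 ?(sn_ge0 hq).
set x := y ^+ 2; set n := (2 ^ m - 1)%N.
have sx : star x = x by rewrite (starX hstar) sy.
have x1 : q x <= 1 by rewrite (sn_sa_sqr hq) // expr_le1 ?(sn_ge0 hq).
have yx : y ^+ 2 = x by [].
clearbody x.
have -> : (2 ^ m.+1 - 1 = 2 * n + 1)%N.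
  rewrite /n expnS; have := expn_gt0 2 m; case: (2 ^ m)%N => // k _.
  by rewrite mulnBr muln1 subn1 mulnS /= !subSS subn0 addn1.
have := IH x sx x1; rewrite -/n => IHx.
suff le : q ((1 - x) * x ^+ (2 * n + 1)) *+ 2 <= q ((1 - x ^+ 2) * (x ^+ 2) ^+ n).
  rewrite exprSr invfM mulrA ler_pdivlMr // mulr_natr.
  exact: le_trans le IHx.
apply: (@le_eps _ _ _ 4) => // e e0.
have [s [ss se]] := sn_sqrt sx x1 e0.
pose u := s * y * x ^+ n; pose v := (1 - x) * x ^+ n.
pose r := s ^+ 2 - (1 - x).
have sv : star v = v.
  by rewrite (starM hstar) (starB hstar) (star1 hstar) (starX hstar) sx mulrC.
have su : star u = u.
  rewrite /u (starM hstar (s * y)) (starM hstar s) (starX hstar x) sx sy ss; ring.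
have xn : x ^+ (2 * n + 1) = x * (x ^+ n) ^+ 2.
  by rewrite addn1 exprS mulnC exprM.
have u2 : u ^+ 2 = (1 - x) * x ^+ (2 * n + 1) + r * x ^+ (2 * n + 1).
  rewrite xn /r.
  have -> : u ^+ 2 = s ^+ 2 * x * (x ^+ n) ^+ 2 by rewrite /u !exprMn yx.
  ring.
have uv : u ^+ 2 *+ 2 + v ^+ 2 =
    (1 - x ^+ 2) * (x ^+ 2) ^+ n + (r * x ^+ (2 * n + 1)) *+ 2.
  have -> : (x ^+ 2) ^+ n = (x ^+ n) ^+ 2 by rewrite -!exprM mulnC.
  by rewrite u2 xn /v; ring.
have qr : q (r * x ^+ (2 * n + 1)) <= e.
  rewrite (le_trans (snM hq _ _)) // -[e]mulr1 ler_pM ?(sn_ge0 hq) //.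
  exact: snX_le1 hstar hq _ _ _.
have mono : q (u ^+ 2) *+ 2 <= q (u ^+ 2 *+ 2 + v ^+ 2).
  (* Rescaling turns 2 u^2 into the square of a self-adjoint element, as [sn_sqr_le] requires. *)
  pose w := (Num.sqrt 2)%:C *: u.
  have w2 : w ^+ 2 = u ^+ 2 *+ 2.
    by rewrite /w exprZn -rmorphXn /= sqr_sqrtr ?ler0n // rmorph_nat scaler_nat.
  have sw : star w = w by rewrite (starZr hstar) su.
  by rewrite -(snMn hq) -w2 (sn_sa_sqr hq) // sn_sqr_le.
have h1 : q ((1 - x) * x ^+ (2 * n + 1)) <= q (u ^+ 2) + e.
  have -> : (1 - x) * x ^+ (2 * n + 1) = u ^+ 2 - r * x ^+ (2 * n + 1).
    by rewrite u2 addrK.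
  by rewrite (le_trans (snB hq _ _)) // lerD2l.
have h2 : q (u ^+ 2 *+ 2 + v ^+ 2) <= q ((1 - x ^+ 2) * (x ^+ 2) ^+ n) + e *+ 2.
  rewrite uv (le_trans (snD hq _ _)) // lerD2l (snMn hq) ler_pMn2r //.
lra.
Qed.

End Commutative.

Section Transfer.
Variables (R : realType) (A : algType R[i]) (star : A -> A) (q : A -> R).
Hypothesis hstar : is_star_involution star.
Hypothesis hq : is_Cstar_seminorm star q.

(* The subalgebra generated by a self-adjoint [y] is a quotient of the
   commutative star-algebra of polynomials. *)
Lemma sn_decay_alg y m : star y = y -> q y <= 1 ->
  q ((1 - y ^+ 2) * (y ^+ 2) ^+ (2 ^ m - 1)) <= 2 / 2 ^+ m.
Proof.
move=> sy y1; pose ev := horner_alg y.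
pose st : {poly R[i]} -> {poly R[i]} := map_poly conjc.
have evX : ev 'X = y by exact: horner_algX.
have evC c : ev c%:P = c%:A by exact: horner_algC.
have evD P Q : ev (P + Q) = ev P + ev Q by exact: rmorphD.
have evM P Q : ev (P * Q) = ev P * ev Q by exact: rmorphM.
have evZ c P : ev (c *: P) = c *: ev P by rewrite -mul_polyC evM evC mulr_algl.
(* Since [y] is self-adjoint, evaluation carries conjugation of coefficients to [star]; hence
   [q \o ev] is a C*-seminorm on polynomials. *)
have evS P : ev (st P) = star (ev P).
  elim/poly_ind: P => [|P c IH].
    by rewrite /st map_poly0 /ev !rmorph0 (star0 hstar).
  have -> : st (P * 'X + c%:P) = 'X * st P + (conjc c)%:P.
    by rewrite /st rmorphD rmorphM /= map_polyX map_polyC mulrC.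
  rewrite !evD !evM evX !evC (starD hstar) (starM hstar) IH sy.
  by rewrite (starZ hstar) (star1 hstar).
have hst : is_star_involution st.
  split => [P Q|c P|P Q|P]; rewrite /st ?rmorphD ?rmorphM //= ?map_polyZ //.
    by rewrite mulrC.
  by rewrite -map_poly_comp_id0 ?map_poly_id // => [x _ /=|]; rewrite ?conjcK ?conjc0.
have hN : is_Cstar_seminorm st (q \o ev).
  split => [P|P Q|c P|P Q|P] /=.
  - exact: sn_ge0 hq _.
  - by rewrite evD; exact: snD hq _ _.
  - by rewrite evZ; exact: snZ hq _ _.
  - by rewrite evM; exact: snM hq _ _.
  - by rewrite evM evS; exact: snC hq _.
have := @sn_decay _ _ _ _ hst hN 'X m; rewrite /= evX => /(_ _ y1).
have evN n P : ev (P ^+ n) = ev P ^+ n by exact: rmorphXn.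
have ev1 : ev (1 - 'X ^+ 2) = 1 - y ^+ 2.
  by rewrite -(evX) -(evN 2%N) /ev rmorphB rmorph1.
rewrite evM ev1 !evN evX; apply.
by rewrite /st map_polyX.
Qed.

End Transfer.

(** * Closed left ideals *)

Lemma le_sum_In (R : realDomainType) (T : Type) (F : seq T) (f : T -> R) l :
  (forall j, 0 <= f j) -> List.In l F -> f l <= \sum_(j <- F) f j.
Proof.
move=> f0; elim: F => [//|a F IH] /= [->|/IH h]; rewrite big_cons.
  by rewrite lerDl sumr_ge0.
by rewrite ler_wpDl.
Qed.

Section LocallyCstarAlgebra.
Variables (R : realType) (A : algType R[i]) (L : Type).
Variables (star : A -> A) (p : L -> A -> R).
Hypothesis hA : locally_Cstar_algebra star p.

Lemma lc_star : is_star_involution star. Proof. by case: hA. Qed.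
Lemma lc_sn l : is_Cstar_seminorm star (p l). Proof. by case: hA. Qed.
Let hs := lc_star.
Let hp := lc_sn.

Lemma lc_eq0 x : (forall l, p l x = 0) -> x = 0.
Proof. by case: hA => _ _ h _ _; apply: h. Qed.

Lemma lc_star_mul_eq0 x : star x * x = 0 -> x = 0.
Proof.
move=> h; apply: lc_eq0 => l; apply/eqP.
by rewrite -sqrf_eq0 -(snC (hp l)) h (sn0 (hp l)).
Qed.

Lemma sn_small l x (c : R) : 0 <= c ->
  (forall e, 0 < e -> p l x <= c * e) -> p l x = 0.
Proof.
move=> c0 h; apply/eqP; rewrite eq_le (sn_ge0 (hp l)) andbT.
by apply: (@le_eps _ _ _ c) => // e /h; rewrite add0r.
Qed.

Definition adherent (S : set A) : set A :=
  [set x | forall (F : seq L) (d : R), 0 < d -> exists s, S s /\ sn_close p F d x s].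

Lemma adherent1 S x l (d : R) : adherent S x -> 0 < d -> exists2 s, S s & p l (x - s) < d.
Proof.
by move=> h d0; have [s [Ss cl]] := h [:: l] d d0; exists s => //; apply: cl; left.
Qed.

Lemma adherent_sub (S : set A) x : S x -> adherent S x.
Proof. by move=> Sx F d d0; exists x; split=> // l _; rewrite subrr (sn0 (hp l)). Qed.

(** This is closedness of [adherent S], because [sn_closed p T] unfolds to the inclusion of
    [adherent T] in [T]. *)
Lemma adherent_adherent S x : adherent (adherent S) x -> adherent S x.
Proof.
move=> h F d d0; have d2 : 0 < d / 2 by rewrite divr_gt0.
have [y [Sy xy]] := h F _ d2; have [s [Ss ys]] := Sy F _ d2.
exists s; split=> // l lF.
rewrite (le_lt_trans (sn_tri (hp l) y _ _)) // [d]splitr ltrD //; [exact: xy|exact: ys].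
Qed.

Lemma adherent_map S T (f : A -> A) (K : L -> R) x :
  (forall l, 0 <= K l) -> (forall l y, p l (f x - f y) <= K l * p l (x - y)) ->
  (forall y, S y -> T (f y)) -> adherent S x -> adherent T (f x).
Proof.
move=> K0 fK ST h F d d0; pose c := 1 + \sum_(l <- F) K l.
have c0 : 0 < c by rewrite ltr_wpDr // sumr_ge0.
have [s [Ss cl]] := h F (d / c) (divr_gt0 d0 c0).
exists (f s); split; first exact: ST.
move=> l lF; rewrite (le_lt_trans (fK _ _)) //.
have Kc : K l <= c by rewrite (le_trans (le_sum_In K0 lF)) // ler_wpDl.
apply: le_lt_trans (ler_wpM2r (sn_ge0 (hp l) _) Kc) _.
by rewrite mulrC -ltr_pdivlMr //; apply: cl.
Qed.

Lemma adherent_left_ideal J : left_ideal J -> left_ideal (adherent J).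
Proof.
move=> [J0 JD JZ JM]; split.
- exact: adherent_sub.
- move=> x y hx hy F d d0; have d2 : 0 < d / 2 by rewrite divr_gt0.
  have [s [Ss xs]] := hx F _ d2; have [t [St yt]] := hy F _ d2.
  exists (s + t); split; first exact: JD.
  move=> l lF; have -> : x + y - (s + t) = (x - s) + (y - t) by rewrite opprD addrACA.
  by rewrite (le_lt_trans (snD (hp l) _ _)) // [d]splitr ltrD //; [exact: xs|exact: yt].
- move=> c x; apply: (@adherent_map J J _ (fun=> absC c)) => [l|l y|y].
  + exact: absC_ge0.
  + by rewrite -scalerBr (snZ (hp l)).
  + exact: JZ.
- move=> a x; apply: (@adherent_map J J _ (p ^~ a)) => [l|l y|y].
  + exact: sn_ge0 (hp l) _.
  + by rewrite -mulrBr (snM (hp l)).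
  + exact: JM.
Qed.

(** Right multiplication is continuous. This carries relations valid on a left ideal over to the
    projection that generates its closure. *)
Lemma adherent_ann S x b : adherent S x -> (forall s, S s -> s * b = 0) -> x * b = 0.
Proof.
move=> h hb; apply: lc_eq0 => l; apply: (@sn_small _ _ (p l b)) => [|e e0].
  exact: sn_ge0 (hp l) _.
have [s Ss xs] := adherent1 l h e0.
have -> : x * b = (x - s) * b by rewrite mulrBl (hb s Ss) subr0.
by rewrite (le_trans (snM (hp l) _ _)) // mulrC ler_wpM2l ?(sn_ge0 (hp l)) // ltW.
Qed.

Lemma adherent_fix S x b : adherent S x -> (forall s, S s -> s * b = s) -> x * b = x.
Proof.
move=> h hb; apply/eqP; rewrite -subr_eq0 -{2}[x]mulr1 -mulrBr.
by apply/eqP; apply: adherent_ann h _ => s Ss; rewrite mulrBr mulr1 hb // subrr.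
Qed.

Lemma close_cat G H (d d1 d2 : R) x y : d <= d1 -> d <= d2 ->
  sn_close p (G ++ H) d x y -> sn_close p G d1 x y /\ sn_close p H d2 x y.
Proof.
move=> h1 h2 cl; split=> l lG.
  by apply: lt_le_trans h1; apply: cl; apply/List.in_or_app; left.
by apply: lt_le_trans h2; apply: cl; apply/List.in_or_app; right.
Qed.

Definition is_proj (e : A) : Prop := star e = e /\ e * e = e.

(** * Projections generating closed left ideals *)

Section Annihilator.
Hypothesis hann : forall J, left_ideal J -> sn_closed p J -> ran J = [set 0] -> J = setT.

(* With J' the left ideal of the x such that x J^* = 0, the sum J + J' has zero right annihilator,
   hence is dense; p l (x) <= p l (x + y) for x in J and y in J', so an
   approximation of 1 by elements of J + J' converges componentwise. *)
Lemma left_ideal_proj J : left_ideal J ->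
  exists e, [/\ is_proj e, forall x, J x -> x * e = x & adherent J e].
Proof.
move=> idJ; have [J0 JD JZ JM] := idJ.
pose J' : set A := [set y | forall v, J v -> y * star v = 0].
have J'0 : J' 0 by move=> v _; rewrite mul0r.
pose S : set A := [set z | exists x y, [/\ J x, J' y & z = x + y]].
have idS : left_ideal S.
  split.
  - by exists 0, 0; rewrite addr0.
  - move=> _ _ [x [y [Jx J'y ->]]] [x1 [y1 [Jx1 J'y1 ->]]].
    exists (x + x1), (y + y1); split; [exact: JD| |by rewrite addrACA].
    by move=> v Jv; rewrite mulrDl J'y // J'y1 // addr0.
  - move=> c _ [x [y [Jx J'y ->]]]; exists (c *: x), (c *: y); split.
    + exact: JZ.
    + by move=> v Jv; rewrite -scalerAl J'y // scaler0.
    + by rewrite scalerDr.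
  - move=> a _ [x [y [Jx J'y ->]]]; exists (a * x), (a * y); split.
    + exact: JM.
    + by move=> v Jv; rewrite -mulrA J'y // mulr0.
    + by rewrite mulrDr.
have S1 : adherent S 1.
  suff -> : adherent S = setT by [].
  apply: hann; first exact: adherent_left_ideal.
    exact: adherent_adherent.
  apply/seteqP; split=> z /=; last by move=> -> s _; rewrite mulr0.
  (* Since J z = 0, the adjoint [star z] lies in [J'], hence in [S], and so [star z * z]
     vanishes. *)
  move=> hz; apply: lc_star_mul_eq0; apply: (hz); apply: adherent_sub.
  exists 0, (star z); rewrite add0r; split=> // v Jv.
  rewrite -(starM hs) hz ?(star0 hs) //; apply: adherent_sub.
  by exists v, 0; rewrite addr0.
(* As y * star x = 0, one has p l x ^ 2 = p l ((x + y) * star x) <= p l (x + y) * p l x. *)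
have contr l x y : J x -> J' y -> p l x <= p l (x + y).
  move=> Jx J'y; have [x0|x0] := eqVneq (p l x) 0; first by rewrite x0 (sn_ge0 (hp l)).
  have xpos : 0 < p l x by rewrite lt_def x0 (sn_ge0 (hp l)).
  rewrite -(ler_pM2r xpos) -expr2 -(snC' hs (hp l)).
  have -> : x * star x = (x + y) * star x by rewrite mulrDl J'y // addr0.
  by rewrite (le_trans (snM (hp l) _ _)) // (sn_star hs (hp l)).
(* The filter of first components [x] of sums [x + y] near 1; [contr], applied to differences, makes
   it Cauchy. *)
pose Phi : set_system A := [set T | exists G (d : R), 0 < d /\
  forall x y, J x -> J' y -> sn_close p G d 1 (x + y) -> T x].
have PhiF : ProperFilter Phi.
  split.
    move=> [G [d [d0 h]]]; have [_ [[x [y [Jx J'y ->]]] cl]] := S1 G d d0.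
    exact: h Jx J'y cl.
  split.
  - by exists [::], 1.
  - move=> T1 T2 [G1 [d1 [d10 h1]]] [G2 [d2 [d20 h2]]].
    exists (G1 ++ G2), (Num.min d1 d2); split; first by rewrite lt_min d10.
    move=> x y Jx J'y /close_cat => /(_ d1 d2); rewrite !ge_min !lexx orbT.
    by case=> // c1 c2; split; [exact: h1 c1|exact: h2 c2].
  - move=> T1 T2 sub [G [d [d0 h]]]; exists G, d; split=> // x y Jx J'y cl.
    exact/sub/(h _ y).
have [e he] : exists e, sn_converges p Phi e.
  case: hA => _ _ _ complete _; apply: complete => // l d d0.
  exists [set x | J x /\ exists2 y, J' y & p l (1 - (x + y)) < d / 2]; split.
    exists [:: l], (d / 2); split; first by rewrite divr_gt0.
    by move=> x y Jx J'y cl; split=> //; exists y => //; apply: cl; left.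
  move=> x x1 [Jx [y J'y xy]] [Jx1 [y1 J'y1 xy1]].
  have Jd : J (x - x1) by apply: JD => //; rewrite -scaleN1r; apply: JZ.
  have J'd : J' (y - y1) by move=> v Jv; rewrite mulrBl J'y // J'y1 // subr0.
  apply: le_lt_trans (contr l _ _ Jd J'd) _.
  have -> : x - x1 + (y - y1) = (x + y - 1) + (1 - (x1 + y1)).
    by rewrite subrKA opprD addrACA.
  rewrite (le_lt_trans (snD (hp l) _ _)) // [d]splitr ltrD //.
  by rewrite (sn_sym (hp l)).
have approx F (d : R) : 0 < d ->
    exists x y, [/\ J x, J' y, sn_close p F d e x & sn_close p F d 1 (x + y)].
  move=> d0; suff : Phi [set x | J x /\
      (sn_close p F d e x /\ exists2 y, J' y & sn_close p F d 1 (x + y))].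
    by move/filter_ex => [x [Jx [ex [y J'y xy]]]]; exists x, y.
  apply: filterS (filterI
    (_ : Phi [set x | J x /\ exists2 y, J' y & sn_close p F d 1 (x + y)])
    (_ : Phi [set x | sn_close p F d e x])).
  - by move=> x [[Jx ?] ?]; split.
  - by exists F, d; split=> // x y Jx J'y cl; split=> //; exists y.
  - elim: F => [|l F IH]; first by apply: filterS filterT => x _ l [].
    apply: filterS (filterI (he l d d0) IH) => x [/= h1 h2] l' [<-|]; last exact: h2.
    by rewrite (sn_sym (hp l)).
have Je : adherent J e by move=> F d d0; have [x [y [Jx _ ex _]]] := approx F d d0; exists x.
(* After taking adjoints the claim is (e - 1) * star v = 0. Adding [y] to e - 1 changes nothing, as
   y * star v = 0, and e - 1 + y = (e - x) - (1 - (x + y)) is small. *)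
have ev v : J v -> v * star e = v.
  move=> Jv; rewrite -[LHS](starK hs) -[RHS](starK hs); congr star.
  rewrite (starM hs) (starK hs); apply/eqP; rewrite -subr_eq0 -{2}[star v]mul1r -mulrBl.
  apply/eqP/lc_eq0 => l; apply: (@sn_small _ _ (2 * p l (star v))) => [|d d0].
    by rewrite mulr_ge0 ?(sn_ge0 (hp l)).
  have [x [y [Jx J'y ex xy]]] := approx [:: l] d d0.
  have -> : (e - 1) * star v = (e - x - (1 - (x + y))) * star v.
    have -> : e - x - (1 - (x + y)) = e - 1 + y.
      by rewrite opprB -[x + y - 1]addrA subrKA addrA addrAC.
    by rewrite [RHS]mulrDl J'y // addr0.
  rewrite (le_trans (snM (hp l) _ _)) // mulrAC ler_wpM2r ?(sn_ge0 (hp l)) //.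
  rewrite (le_trans (snB (hp l) _ _)) // mulr_natl mulr2n lerD // ltW //.
    by apply: ex; left.
  by apply: xy; left.
have ee : e * star e = e by exact: adherent_fix Je ev.
have se : star e = e by rewrite -{1}ee (starM hs) (starK hs).
by exists e; split=> //; [split=> //; rewrite -{2}se|move=> x /ev; rewrite se].
Qed.

End Annihilator.
End LocallyCstarAlgebra.

(** * Minimal projections *)

Section Projections.
Variables (R : realType) (A : algType R[i]) (L : Type).
Variables (star : A -> A) (p : L -> A -> R).
Hypothesis hA : locally_Cstar_algebra star p.
Hypothesis hann : forall J, left_ideal J -> sn_closed p J -> ran J = [set 0] -> J = setT.
Let hs := lc_star hA.
Let hp := lc_sn hA.
Local Notation proj := (is_proj star).

Lemma projB e f : proj e -> proj f -> f * e = f -> proj (e - f).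
Proof.
move=> [se ee] [sf ff] fe; have ef : e * f = f by rewrite -se -sf -(starM hs) fe.
split; first by rewrite (starB hs) se sf.
by rewrite mulrBl !mulrBr ee ef fe ff subrr subr0.
Qed.

Lemma proj_absorb_sym e f : proj e -> proj f -> f * e = f -> e * f = f.
Proof. by move=> [se _] [sf _] fe; rewrite -se -{1}sf -(starM hs) fe sf. Qed.

Lemma proj_orth_sym e f : proj e -> proj f -> f * e = 0 -> e * f = 0.
Proof. by move=> [se _] [sf _] fe; rewrite -se -sf -(starM hs) fe (star0 hs). Qed.

(** As the ideal is two-sided, [e * a] stays in its closure, so e a e = e a; the adjoint of this
    relation for [star a] is e a e = a e. *)
Lemma ideal_central_proj J : left_ideal J -> (forall a x, J x -> J (x * a)) ->
  exists e, [/\ proj e, forall a, e * a = a * e, forall x, J x -> x * e = x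
    & adherent p J e].
Proof.
move=> idJ JR; have [e [pe Je ade]] := left_ideal_proj hA hann idJ.
exists e; split=> //; have h a : e * a * e = e * a.
  apply: (@adherent_fix _ _ _ _ _ hA J) => //.
  apply: (@adherent_map _ _ _ _ _ hA J J (fun x => x * a) (p ^~ a)) ade => [l|l y|y].
  - exact: sn_ge0 (hp l) _.
  - by rewrite -mulrBl mulrC (snM (hp l)).
  - exact: JR.
move=> a; rewrite -h; have := congr1 star (h (star a)).
by rewrite !(starM hs) (starK hs) pe.1 mulrA.
Qed.

(** The kernel of [p l] is a two-sided ideal; [z] is the complement of its central generating
    projection, so [p l] is a norm on A z. *)
Lemma sn_support l : exists z, [/\ proj z, forall a, z * a = a * z, p l (1 - z) = 0
  & forall x, x * z = x -> p l x = 0 -> x = 0].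
Proof.
have id : left_ideal [set x | p l x = 0].
  split=> /=; first exact: sn0 (hp l).
  - move=> x y x0 y0; apply/eqP; rewrite eq_le (sn_ge0 (hp l)) andbT.
    by rewrite (le_trans (snD (hp l) _ _)) // x0 y0 addr0.
  - by move=> c x x0; rewrite (snZ (hp l)) x0 mulr0.
  - move=> a x x0; apply/eqP; rewrite eq_le (sn_ge0 (hp l)) andbT.
    by rewrite (le_trans (snM (hp l) _ _)) // x0 mulr0.
have [|e [[se ee] ce Je ade]] := ideal_central_proj id.
  move=> a x /= x0; apply/eqP; rewrite eq_le (sn_ge0 (hp l)) andbT.
  by rewrite (le_trans (snM (hp l) _ _)) // x0 mul0r.
exists (1 - e); split.
- by apply: projB; rewrite ?mulr1 //; split; rewrite ?(star1 hs) ?mulr1.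
- by move=> a; rewrite mulrBl mulrBr ce mul1r mulr1.
- rewrite opprB addrC subrK; apply: (sn_small hA ler01) => d d0.
  have [s /= s0 es] := adherent1 l ade d0.
  by rewrite -(subrK s e) (le_trans (snD (hp l) _ _)) // s0 addr0 mul1r ltW.
- move=> x; rewrite mulrBr mulr1 => /eqP.
  rewrite subr_eq -subr_eq0 opprD addNKr oppr_eq0 => /eqP xe.
  by move=> /Je; rewrite xe.
Qed.

(* All g_n - g_(n+1) have p l-norm 1 and lie in the left ideal of the x killed
   by some g_n; but its generating projection is p l-close to such an x. *)
Lemma proj_chain_stops l (g : nat -> A) :
  (forall x, x * g 0%N = x -> p l x = 0 -> x = 0) ->
  (forall n, proj (g n)) -> (forall n, g n.+1 * g n = g n.+1) ->
  exists n, g n.+1 = g n.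
Proof.
move=> norm pg gS; apply: contrapT => /forallNP gN.
have gle n k : g (n + k)%N * g n = g (n + k)%N.
  by elim: k => [|k IH]; rewrite ?addn0 ?(pg n).2 // addnS -{1}gS -mulrA IH gS.
pose J : set A := [set x | exists n, x * g n = 0].
have Jup x n k : x * g n = 0 -> x * g (n + k)%N = 0.
  move=> x0; rewrite -(proj_absorb_sym (pg n) (pg (n + k)%N) (gle n k)).
  by rewrite mulrA x0 mul0r.
have idJ : left_ideal J.
  split.
  - by exists 0%N; rewrite mul0r.
  - move=> x y [n xn] [k yk]; exists (n + k)%N.
    by rewrite mulrDl Jup // addnC Jup // addr0.
  - by move=> c x [n xn]; exists n; rewrite -scalerAl xn scaler0.
  - by move=> a x [n xn]; exists n; rewrite -mulrA xn mulr0.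
have [e [pe Je ade]] := left_ideal_proj hA hann idJ.
have h0 : (0 : R) < 1 / 2 by lra.
have [y [n yn] ey] := adherent1 l ade h0.
pose f := g n - g n.+1.
have pf : proj f by apply: projB.
have fe : f * e = f.
  by apply: Je; exists n.+1; rewrite mulrBl (pg n.+1).2 (proj_absorb_sym _ _ (gS n)) // subrr.
have gf : g n * f = f by rewrite mulrBr (pg n).2 (proj_absorb_sym _ _ (gS n)).
have f0 : f != 0 by rewrite subr_eq0 eq_sym; apply/eqP/gN.
have f1 : p l f = 1.
  have [pf0|//] := sn_proj (hp l) pf.1 pf.2.
  move: f0; rewrite (norm f) ?eqxx // /f mulrBl -{1}[n]add0n gle.
  by rewrite -[n.+1]add0n gle.
(* Here (e - y) * f = f, because e * f = f and y * f = y * g n * f = 0; so 1 < 1 / 2. *)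
have : p l ((e - y) * f) <= p l (e - y) by rewrite (le_trans (snM (hp l) _ _)) // f1 mulr1.
rewrite mulrBl (proj_absorb_sym pe pf fe) -{2}gf mulrA yn mul0r subr0 f1.
lra.
Qed.

(** The class [Q] is instantiated twice: with all projections and with the central ones. *)
Definition minimal_in (Q : A -> Prop) (e : A) : Prop :=
  [/\ Q e, e <> 0 & forall f, Q f -> f * e = f -> f = 0 \/ f = e].

Definition orth_decomp (Q : A -> Prop) (g : A) (s : seq A) : Prop :=
  [/\ forall e, e \in s -> minimal_in Q e, pairwise (fun e f => e * f == 0) s
    & \sum_(e <- s) e = g].

Lemma orth_decomp_absorb Q g s e : (forall f, Q f -> proj f) ->
  orth_decomp Q g s -> e \in s -> e * g = e.
Proof.
move=> Qp [ms + <-]; elim: s ms => [//|f s IH] ms /= /andP[/allP fs ps].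
have pr x : x \in f :: s -> proj x by move=> /ms [/Qp].
have ps' x : x \in s -> minimal_in Q x by move=> xs; apply: ms; rewrite inE xs orbT.
rewrite big_cons mulrDr inE => /orP[/eqP->|es].
  rewrite mulr_sumr big_seq big1 => [|x /fs/eqP//].
  by rewrite addr0 (pr f _).2 ?mem_head.
rewrite IH // proj_orth_sym ?add0r //; [|by apply: pr; rewrite mem_head|exact/eqP/fs].
by apply: pr; rewrite inE es orbT.
Qed.

(** An element of [Q] without decomposition is neither zero nor minimal, so it splits as f + (x -
    f), and one of the two parts again has no decomposition. Iterating gives a strictly decreasing
    chain, against [proj_chain_stops]. *)
Lemma orth_decomp_exists (Q : A -> Prop) l g : (forall f, Q f -> proj f) ->
  (forall e f, Q e -> Q f -> f * e = f -> Q (e - f)) ->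
  (forall x, x * g = x -> p l x = 0 -> x = 0) -> Q g ->
  exists s, orth_decomp Q g s.
Proof.
move=> Qp QB norm Qg; apply: contrapT => badg.
pose bad x := Q x /\ ~ exists s, orth_decomp Q x s.
have step x : exists y, bad x -> [/\ bad y, y * x = y & y <> x].
  (* The value 0 is a mere default for elements that are not bad. *)
  have [[Qx bx]|nb] := pselect (bad x); last by exists 0.
  have [f [Qf fx f0 fNx]] : exists f, [/\ Q f, f * x = f, f <> 0 & f <> x].
    apply: contrapT => /forallNP nf; apply: bx.
    have [->|x0] := eqVneq x 0; first by exists [::]; split=> //; rewrite big_nil.
    exists [:: x]; split=> // [e|]; last by rewrite big_seq1.
    rewrite inE => /eqP->; split=> //; first exact/eqP.
    move=> f Qf fx; have [->|f0] := eqVneq f 0; [by left|right].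
    apply: contrapT => fNx; apply: (nf f); split=> //; exact/eqP.
  have Qxf := QB _ _ Qx Qf fx.
  have xf := proj_absorb_sym (Qp _ Qx) (Qp _ Qf) fx.
  have [bf|nbf] := pselect (bad f); first by exists f.
  exists (x - f) => _; split.
  - split=> // -[s2 d2]; apply: nbf; split=> // -[s1 d1]; apply: bx.
    exists (s1 ++ s2); split.
    + by move=> e; rewrite mem_cat => /orP[]; [have [h _ _] := d1|have [h _ _] := d2]; apply: h.
    + rewrite pairwise_cat; have [_ -> _] := d1; have [m2 -> _] := d2; rewrite !andbT.
      apply/allrelP => a b as1 bs2; apply/eqP.
      rewrite -(orth_decomp_absorb Qp d1 as1) -mulrA.
      have [Qb _ _] := m2 b bs2.
      rewrite -(proj_absorb_sym (Qp _ Qxf) (Qp _ Qb) (orth_decomp_absorb Qp d2 bs2)).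
      by rewrite (mulrA f) mulrBr fx (Qp _ Qf).2 subrr mul0r mulr0.
    + by rewrite big_cat /=; have [_ _ ->] := d1; have [_ _ ->] := d2; rewrite addrC subrK.
  - by rewrite mulrBl fx (Qp _ Qx).2.
  - by move=> /eqP; rewrite subr_eq -subr_eq0 opprD addNKr oppr_eq0 => /eqP.
have [next hn] := choice step.
pose G n := iter n next g.
have bG n : bad (G n) by elim: n => [//|n /hn[]].
have GS n : G n.+1 * G n = G n.+1 by have [] := hn _ (bG n).
have [n /eqP] := @proj_chain_stops l G norm (fun n => Qp _ (bG n).1) GS.
by apply/negP/eqP; have [] := hn _ (bG n).
Qed.

Definition minimal_proj := minimal_in proj.

(** The projection [g] generating the closure of A x satisfies g e = g, and it is nonzero because x
    g = x; minimality forces g = e. *)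
Lemma minimal_proj_adherent e x : minimal_proj e -> x * e = x -> x <> 0 ->
  adherent p [set y | exists a, y = a * x] e.
Proof.
move=> [pe _ me] xe x0.
have id : left_ideal [set y | exists a, y = a * x].
  split.
  - by exists 0; rewrite mul0r.
  - by move=> _ _ [a ->] [b ->]; exists (a + b); rewrite mulrDl.
  - by move=> c _ [a ->]; exists (c *: a); rewrite scalerAl.
  - by move=> b _ [a ->]; exists (b * a); rewrite mulrA.
have [g [pg Jg adg]] := left_ideal_proj hA hann id.
have ge : g * e = g by apply: (adherent_fix hA adg) => _ [a ->]; rewrite -mulrA xe.
have xg : x * g = x by apply: Jg; exists 1; rewrite mul1r.
have [g0|ge'] := me g pg ge; last by rewrite -ge'.
by case: x0; rewrite -xg g0 mulr0.
Qed.

(** If [p l] vanished at [x], it would vanish on A x, which could then not approach [e]. *)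
Lemma minimal_proj_sn_neq0 e x l : minimal_proj e -> x * e = x -> x <> 0 ->
  p l e = 1 -> p l x <> 0.
Proof.
move=> me xe x0 e1 px; have ad := minimal_proj_adherent me xe x0.
have h0 : (0 : R) < 1 by [].
have [_ [a ->]] := adherent1 l ad h0; apply/negP; rewrite -leNgt -e1.
rewrite -{1}[e](subrK (a * x)) (le_trans (snD (hp l) _ _)) //.
have := snM (hp l) a x; rewrite px mulr0; lra.
Qed.

Lemma minimal_proj_sn e : minimal_proj e -> exists l, p l e = 1.
Proof.
move=> [[se ee] e0 _]; apply: contrapT => /forallNP h; apply: e0; apply: (lc_eq0 hA) => l.
by have [//|/h] := sn_proj (hp l) se ee.
Qed.

(* If [e - y^2] were nonzero, it would have an approximate left inverse, contradicting
   [p l ((e - y^2) y^(2n)) -> 0] and [p l (y^(2n)) = 1]. *)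
Lemma minimal_proj_sa_sqr e y l : minimal_proj e -> p l e = 1 ->
  star y = y -> y * e = y -> p l y = 1 -> y ^+ 2 = e.
Proof.
move=> me e1 sy ye y1; have [[se ee] _ _] := me.
have ey : e * y = y by rewrite -se -sy -(starM hs) ye sy.
set x := y ^+ 2; apply/eqP; rewrite eq_sym -subr_eq0; apply/negP => /negP/eqP z0.
have sx : star x = x by rewrite (starX hs) sy.
have x1 : p l x = 1 by rewrite (sn_sa_sqr (hp l)) // y1 expr1n.
have xn n : p l (x ^+ n) = 1 by apply: snX_eq1 hs (hp l) _ _ _ _.
have ze : (e - x) * e = e - x by rewrite mulrBl ee /x expr2 -mulrA ye.
have h0 : (0 : R) < 1 / 2 by lra.
have [_ [a ->] ha] := adherent1 l (minimal_proj_adherent me ze z0) h0.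
(* Chosen so that p l a * (2 / 2^m) <= 1 / 2; the other summand is below 1 / 2, and the two bound p
   l (x^n) = 1. *)
pose m := (Num.truncn (4 * p l a)).+1.
have hm : 4 * p l a < 2 ^+ m.
  apply: lt_trans (truncnS_gt _) _.
  by rewrite -natrX ltr_nat -/m ltn_expl.
pose n := (2 ^ m - 1)%N.
(* Positivity matters for [ex]: the power [x ^+ 0] is 1, and e * 1 is [e]. *)
have n0 : (0 < n)%N by rewrite subn_gt0 -(expn0 2) ltn_exp2l.
have ex : e * x ^+ n = x ^+ n by rewrite -(prednK n0) exprS mulrA /x expr2 mulrA ey.
have y_le1 : p l y <= 1 by rewrite y1.
have dec := sn_decay_alg hs (hp l) m sy y_le1.
have : p l (x ^+ n) <= p l (e - a * (e - x)) * p l (x ^+ n) + p l a * p l ((1 - x) * x ^+ n).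
  have -> : (1 - x) * x ^+ n = (e - x) * x ^+ n by rewrite !mulrBl ex mul1r.
  rewrite -{1}ex -{1}[e](subrK (a * (e - x))) mulrDl (le_trans (snD (hp l) _ _)) //.
  by rewrite lerD ?(snM (hp l)) // -mulrA (snM (hp l)).
rewrite xn mulr1 => h.
have h2 : p l a * p l ((1 - x) * x ^+ n) <= 1 / 2.
  apply: le_trans (ler_wpM2l (sn_ge0 (hp l) a) dec) _.
  by rewrite mulrA ler_pdivrMr ?exprn_gt0 //; lra.
lra.
Qed.

(** Scaling to norm 1 gives y^2 = t^2 e, so (y - t e)(y + t e) = 0. If y - t e is nonzero, its left
    multiples approach [e], hence e (y + t e) = 0 and y = - t e. *)
Lemma minimal_proj_sa e y : minimal_proj e -> star y = y -> y * e = y ->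
  exists t : R, y = t%:C *: e.
Proof.
move=> me sy ye; have [[se ee] _ _] := me.
have [y0|/eqP y0] := eqVneq y 0; first by exists 0; rewrite scale0r.
have ey : e * y = y by rewrite -se -sy -(starM hs) ye sy.
have [l e1] := minimal_proj_sn me.
have t0 := minimal_proj_sn_neq0 me ye y0 e1; set t := p l y in t0.
have tN : t%:C != 0 :> R[i] by rewrite fmorph_eq0; apply/eqP.
have : (t^-1%:C *: y) ^+ 2 = e.
  apply: (minimal_proj_sa_sqr me e1).
  - by rewrite (starZr hs) sy.
  - by rewrite -scalerAl ye.
  - rewrite (snZr (hp l)) ger0_norm ?invr_ge0 ?(sn_ge0 (hp l)) // mulVf //; exact/eqP.
rewrite exprZn => yy; have {}yy : y ^+ 2 = (t%:C ^+ 2) *: e.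
  by rewrite -yy scalerA -exprMn fmorphV mulfV // expr1n scale1r.
pose z := y - t%:C *: e.
have ze : z * e = z by rewrite mulrBl -scalerAl ye ee.
have zz : z * (y + t%:C *: e) = 0.
  rewrite mulrBl !mulrDr -!scalerAl -!scalerAr ee ye ey -expr2 yy scalerA -expr2.
  by rewrite [_ *: y + _]addrC subrr.
have [/eqP|/eqP z0] := eqVneq z 0; first by rewrite subr_eq0 => /eqP; exists t.
have : e * (y + t%:C *: e) = 0.
  by apply: (adherent_ann hA (minimal_proj_adherent me ze z0)) => _ [a ->]; rewrite -mulrA zz mulr0.
rewrite mulrDr ey -scalerAr ee => /eqP; rewrite addr_eq0 => /eqP->.
by exists (- t); rewrite rmorphN scaleNr.
Qed.

(** The self-adjoint case applies to the real and imaginary parts of [x]. *)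
Lemma minimal_proj_corner e x : minimal_proj e -> exists c : R[i], e * x * e = c *: e.
Proof.
move=> me; have [[se ee] _ _] := me.
have sa y : star y = y -> exists t : R, e * y * e = t%:C *: e.
  move=> sy; apply: minimal_proj_sa => //; last by rewrite -mulrA ee.
  by rewrite !(starM hs) se sy mulrA.
have [t1 h1] : exists t : R, e * (x + star x) * e = t%:C *: e.
  by apply: sa; rewrite (starD hs) (starK hs) addrC.
pose w := 'i%C *: (x - star x).
have [t2 h2] : exists t : R, e * w * e = t%:C *: e.
  apply: sa; rewrite /w (starZ hs) (starB hs) (starK hs) -[in RHS]opprB scalerN -scaleNr.
  by congr (_ *: _); apply/eqP; rewrite eq_complex /= oppr0 !eqxx.
exists (2^-1 * (t1%:C - 'i%C * t2%:C)).
have -> : x = 2^-1 *: ((x + star x) - 'i%C *: w).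
  rewrite /w scalerA -expr2 sqr_i scaleN1r opprK addrACA subrr addr0 -mulr2n -[x *+ 2]scaler_nat.
  by rewrite scalerA mulVf ?pnatr_eq0 // scale1r.
rewrite -scalerAr -scalerAl mulrBr mulrBl h1 -(scalerAr 'i%C e w) -scalerAl h2.
by rewrite scalerA -scalerBl scalerA.
Qed.
End Projections.

(** * Products of matrix blocks *)

Lemma In_mem (T : eqType) (s : seq T) (x : T) : List.In x s <-> x \in s.
Proof.
elim: s => [//|y s IH]; rewrite inE /= IH.
by split=> [[->|->]|/orP[/eqP->|->]]; rewrite ?eqxx ?orbT; auto.
Qed.

Section MatrixUnits.
Variables (R : realType) (A : algType R[i]) (L : Type).
Variables (star : A -> A) (p : L -> A -> R).
Hypothesis hA : locally_Cstar_algebra star p.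
Let hs := lc_star hA.
Let hp := lc_sn hA.

(** Completeness in inverse-limit form: the conditions p l (x - y l) = 0 generate a Cauchy filter.
    Solvability is asked for finite sets of indices, since the family of seminorms need not be
    directed. *)
Lemma sn_glue (y : L -> A) :
  (forall F : seq L, exists x, forall l, List.In l F -> p l (x - y l) = 0) ->
  exists x, forall l, p l (x - y l) = 0.
Proof.
move=> h; pose Phi : set_system A :=
  [set T | exists F, forall x, (forall l, List.In l F -> p l (x - y l) = 0) -> T x].
have PhiF : ProperFilter Phi.
  split; first by move=> [F hF]; have [x /hF] := h F.
  split.
  - by exists [::].
  - move=> T1 T2 [F1 h1] [F2 h2]; exists (F1 ++ F2) => x hx.
    by split; [apply: h1|apply: h2] => l lF; apply: hx; apply/List.in_or_app; [left|right].
  - by move=> T1 T2 sub [F hF]; exists F => x /hF /sub.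
have Phi1 l : Phi [set x | p l (x - y l) = 0] by exists [:: l] => x; apply; left.
have [a ha] : exists a, sn_converges p Phi a.
  case: hA => _ _ _ complete _; apply: complete => // l e e0.
  exists [set x | p l (x - y l) = 0]; split=> // x x' /= hx hx'.
  rewrite (le_lt_trans (sn_tri (hp l) (y l) _ _)) // hx add0r.
  by rewrite (sn_sym (hp l)) hx'.
exists a => l; apply: (sn_small hA ler01) => e e0.
have [x [/= h1 h2]] := filter_ex (filterI (ha l e e0) (Phi1 l)).
rewrite (le_trans (sn_tri (hp l) x _ _)) // h2 addr0 mul1r ltW //.
by rewrite (sn_sym (hp l)).
Qed.

(** The [u i] are partial isometries with common initial projection [e v] and orthogonal ranges
    summing to [W v], so the products [u i * star (u j)] are matrix units of the block A W_v. The
    list [sl l] names finitely many blocks that [p l] sees. *)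
Variables (I : eqType) (W e : I -> A) (n : I -> nat).
Variables (u : forall v, 'I_(n v) -> A) (l0 : I -> L) (sl : L -> seq I).
Hypothesis WC : forall v a, W v * a = a * W v.
Hypothesis W_orth : forall v v', v <> v' -> W v * W v' = 0.
Hypothesis e_proj : forall v, is_proj star (e v).
Hypothesis e_corner : forall v x, exists c : R[i], e v * x * e v = c *: e v.
Hypothesis e_sn : forall v, p (l0 v) (e v) = 1.
Hypothesis u_e : forall v (i : 'I_(n v)), u i * e v = u i.
Hypothesis u_orth : forall v (i j : 'I_(n v)), star (u i) * u j = if i == j then e v else 0.
Hypothesis u_sum : forall v, \sum_(i < n v) u i * star (u i) = W v.
Hypothesis sl_W : forall l, p l (1 - \sum_(v <- sl l) W v) = 0.

Lemma e_inj v (c d : R[i]) : c *: e v = d *: e v -> c = d.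
Proof.
move=> /eqP; rewrite -subr_eq0 -scalerBl => /eqP h.
have := snZ (hp (l0 v)) (c - d) (e v); rewrite h (sn0 (hp _)) e_sn mulr1.
by move=> /esym/ComplexField.Normc.eq0_normc/eqP; rewrite subr_eq0 => /eqP.
Qed.

Lemma W_u v (i : 'I_(n v)) : W v * u i = u i.
Proof.
rewrite -u_sum mulr_suml (bigD1 i) //= big1 => [|j ji].
  by rewrite -mulrA u_orth eqxx u_e addr0.
by rewrite -mulrA u_orth (negPf ji) mulr0.
Qed.

Lemma e_ustar v (i : 'I_(n v)) : e v * star (u i) = star (u i).
Proof. by rewrite -{2}(u_e i) (starM hs) (e_proj v).1. Qed.

Lemma W_star v : star (W v) = W v.
Proof.
rewrite -u_sum (star_sum hs); apply: eq_bigr => i _.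
by rewrite (starM hs) (starK hs).
Qed.

Lemma W_idem v : W v * W v = W v.
Proof. by rewrite -{2 3}u_sum mulr_sumr; apply: eq_bigr => i _; rewrite mulrA W_u. Qed.

Lemma sn_u_le1 l v (i : 'I_(n v)) : p l (u i) <= 1.
Proof.
have := snC (hp l) (u i); rewrite u_orth eqxx => h.
rewrite -(@expr_le1 _ 2) ?(sn_ge0 (hp l)) // -h.
by case: (e_proj v) => se ee; apply: (sn_proj_le1 (hp l) se ee).
Qed.

Definition coef v (x : A) : R[i] := projT1 (cid (e_corner v x)).

Lemma coefE v x : e v * x * e v = coef v x *: e v.
Proof. exact: projT2 (cid (e_corner v x)). Qed.

Definition to_mx (x : A) : mxprod R n :=
  fun v => \matrix_(i, j) coef v (star (u i) * x * u j).

Lemma to_mxE x v i j : star (u i) * x * u j = to_mx x v i j *: e v.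
Proof. by rewrite mxE -coefE !mulrA e_ustar -[RHS]mulrA u_e. Qed.

Lemma to_mx_uniq x v (M : 'M_(n v)) :
  (forall i j, star (u i) * x * u j = M i j *: e v) -> to_mx x v = M.
Proof. by move=> h; apply/matrixP => i j; apply: (@e_inj v); rewrite -to_mxE h. Qed.

Lemma to_mx_star_hom : is_star_hom star to_mx.
Proof.
split.
- move=> x y v; apply: to_mx_uniq => i j.
  rewrite mulrDr mulrDl !to_mxE; move: (to_mx x v) (to_mx y v) => M N.
  by rewrite mxE scalerDl.
- move=> c x v; apply: to_mx_uniq => i j.
  rewrite -scalerAr -scalerAl to_mxE; move: (to_mx x v) => M.
  by rewrite mxE scalerA.
- move=> x y v; apply: to_mx_uniq => i j.
  (* The central [W v] fixes [u j], so it can be inserted between [x] and [y]; expanding it as the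
     sum of the u_k u_k^* produces the matrix product. *)
  have -> : star (u i) * (x * y) * u j = star (u i) * x * W v * (y * u j).
    by rewrite -!mulrA (mulrA (W v)) WC -(mulrA y) W_u.
  rewrite -u_sum mulr_sumr mulr_suml [in RHS]mxE scaler_suml; apply: eq_bigr => k _.
  have -> : star (u i) * x * (u k * star (u k)) * (y * u j) =
     (star (u i) * x * u k) * (star (u k) * y * u j) by rewrite !mulrA.
  by rewrite !to_mxE -scalerAl -scalerAr (e_proj v).2 scalerA.
- move=> v; apply: to_mx_uniq => i j; rewrite mulr1 u_orth mxE.
  by case: eqP; rewrite ?scale1r ?scale0r.
- move=> x v; apply: to_mx_uniq => i j; have := congr1 star (to_mxE x j i).
  rewrite !(starM hs) (starK hs) (starZ hs) (e_proj v).1 mulrA => ->.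
  by move: (to_mx x v) => M; rewrite !mxE.
Qed.

Lemma to_mxB x y v : to_mx (x - y) v = to_mx x v - to_mx y v.
Proof.
apply: to_mx_uniq => i j.
rewrite mulrBr mulrBl !to_mxE; move: (to_mx x v) (to_mx y v) => M N.
by rewrite 2!mxE scalerBl.
Qed.

Lemma absC_to_mx x v i j : absC (to_mx x v i j) <= p (l0 v) x.
Proof.
rewrite -[X in X <= _]mulr1 -(e_sn v) -(snZ (hp _)) -to_mxE.
rewrite (le_trans (snM (hp _) _ _)) // -[leRHS]mulr1 ler_pM ?(sn_ge0 (hp _)) ?sn_u_le1 //.
rewrite (le_trans (snM (hp _) _ _)) // -[leRHS]mul1r ler_pM ?(sn_ge0 (hp _)) //.
by rewrite (sn_star hs (hp _)) sn_u_le1.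
Qed.

Lemma to_mx_continuous : sn_to_prod_continuous p to_mx.
Proof.
move=> x G d d0; exists (map l0 G), d; split=> // y cl v vG j k.
rewrite -[_ - _]/(to_mx x v j k + (- to_mx y v j k)).
have -> : to_mx x v j k + (- to_mx y v j k) = to_mx (x - y) v j k.
  by rewrite to_mxB; move: (to_mx x v) (to_mx y v) => M N; rewrite !mxE.
apply: le_lt_trans (absC_to_mx _ _ _) _; apply: cl.
exact: List.in_map.
Qed.

Definition of_mx v (M : 'M[R[i]]_(n v)) : A :=
  \sum_i \sum_j M i j *: (u i * star (u j)).

Lemma of_mxK v (M : 'M_(n v)) i j : star (u i) * of_mx M * u j = M i j *: e v.
Proof.
rewrite /of_mx mulr_sumr mulr_suml (bigD1 i) //= [X in _ + X]big1 ?addr0.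
  rewrite mulr_sumr mulr_suml (bigD1 j) //= [X in _ + X]big1 ?addr0.
    rewrite -scalerAr -scalerAl !mulrA u_orth eqxx e_ustar u_orth eqxx //.
  move=> k kj; rewrite -scalerAr -scalerAl -!mulrA u_orth (negPf kj).
  by rewrite !mulr0 scaler0.
move=> k ki; rewrite mulr_sumr mulr_suml big1 // => m _.
by rewrite -scalerAr -scalerAl !mulrA u_orth eq_sym (negPf ki) !mul0r scaler0.
Qed.

Lemma of_to_mx x v : of_mx (to_mx x v) = W v * x.
Proof.
have -> : W v * x = W v * x * W v by rewrite -mulrA -WC mulrA W_idem.
rewrite -u_sum /of_mx !mulr_suml; apply: eq_bigr => i _; rewrite mulr_sumr; apply: eq_bigr => j _.
have -> : u i * star (u i) * x * (u j * star (u j)) =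
  u i * (star (u i) * x * u j) * star (u j) by rewrite !mulrA.
by rewrite to_mxE -scalerAr -scalerAl u_e.
Qed.

Lemma W_of_mx v (M : 'M_(n v)) : W v * of_mx M = of_mx M :> A.
Proof.
rewrite /of_mx mulr_sumr; apply: eq_bigr => i _; rewrite mulr_sumr.
by apply: eq_bigr => j _; rewrite -scalerAr mulrA W_u.
Qed.

Lemma sn_of_mx l v (M : 'M_(n v)) (d : R) : (forall i j, absC (M i j) <= d) ->
  p l (of_mx M) <= (n v ^ 2)%:R * d.
Proof.
move=> hM; apply: le_trans (sn_sum (hp l) _ _ _) _.
have -> : (n v ^ 2)%:R * d = \sum_(i < n v) (n v)%:R * d.
  by rewrite sumr_const card_ord expnS expn1 natrM -mulrA -[RHS]mulr_natl.
apply: ler_sum => i _; apply: le_trans (sn_sum (hp l) _ _ _) _.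
have -> : (n v)%:R * d = \sum_(j < n v) d by rewrite sumr_const card_ord mulr_natl.
apply: ler_sum => j _; rewrite (snZ (hp l)) -[leRHS]mulr1 ler_pM ?(sn_ge0 (hp l)) //.
  exact: absC_ge0.
rewrite (le_trans (snM (hp l) _ _)) // mulr_ile1 ?(sn_ge0 (hp l)) ?(sn_star hs (hp l)) //;
  exact: sn_u_le1.
Qed.

Lemma sn_sub_sl l x : p l (x - (\sum_(v <- sl l) W v) * x) = 0.
Proof.
apply/eqP; rewrite eq_le (sn_ge0 (hp l)) andbT -{1}[x]mul1r -mulrBl.
by rewrite (le_trans (snM (hp l) _ _)) // sl_W mul0r.
Qed.

(** Modulo the kernel of [p l], an element is the sum of its blocks W_v x over [sl l], and each
    block is recovered from its matrix. *)
Lemma to_mx_inj x y : (forall v, to_mx x v = to_mx y v) -> x = y.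
Proof.
move=> h; apply/eqP; rewrite -subr_eq0; apply/eqP/(lc_eq0 hA) => l.
have := sn_sub_sl l (x - y); suff -> : (\sum_(v <- sl l) W v) * (x - y) = 0 by rewrite subr0.
rewrite mulr_suml big1_seq // => v _.
rewrite -of_to_mx to_mxB h subrr /of_mx big1 // => i _; rewrite big1 // => j _.
by rewrite mxE scale0r.
Qed.

Lemma W_of_mx_sum v (a : mxprod R n) s : uniq s -> v \in s ->
  W v * (\sum_(v' <- s) of_mx (a v')) = of_mx (a v).
Proof.
move=> us vs; rewrite mulr_sumr (bigD1_seq v) //= W_of_mx big1 ?addr0 // => v' /eqP vv'.
by rewrite -W_of_mx mulrA W_orth ?mul0r // => /esym.
Qed.

(** Each seminorm sees only the finite sum [y l], and the sums [X s] over larger finite sets of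
    blocks agree with it modulo [p l], so [sn_glue] applies. *)
Lemma to_mx_surj (a : mxprod R n) : exists x, forall v, to_mx x v = a v.
Proof.
pose y l := \sum_(v <- sl l) of_mx (a v).
(* Concatenating lists [sl l] may repeat an index; [undup] keeps a block from being counted
   twice. *)
pose X s : A := \sum_(v <- undup s) of_mx (a v).
have Xy s l : {subset sl l <= s} -> p l (X s - y l) = 0.
  move=> sub; suff -> : y l = (\sum_(v <- sl l) W v) * X s by exact: sn_sub_sl.
  rewrite mulr_suml /y big_seq [RHS]big_seq; apply: eq_bigr => v /sub vs.
  by rewrite W_of_mx_sum ?undup_uniq ?mem_undup.
have [x hx] : exists x, forall l, p l (x - y l) = 0.
  apply: sn_glue => F; exists (X (flatten (map sl F))) => l lF; apply: Xy => v vl.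
  elim: F lF => [//|l' F IH] /= [->|/IH h]; rewrite mem_cat ?vl //.
  by rewrite h orbT.
(* Putting [v] in front ensures that the block [v] occurs in [X s]; [p (l0 v)] controls its
   entries. *)
exists x => v; apply/matrixP => i j; pose s := v :: sl (l0 v).
have Xx : p (l0 v) (x - X s) = 0.
  apply/eqP; rewrite eq_le (sn_ge0 (hp _)) andbT.
  rewrite (le_trans (sn_tri (hp _) (y (l0 v)) _ _)) // hx add0r (sn_sym (hp _)) Xy //.
  by move=> w ws; rewrite inE ws orbT.
have aX : to_mx (X s) v i j = a v i j.
  apply: (@e_inj v); rewrite -to_mxE -[u j]W_u mulrA -(mulrA _ _ (W v)) -WC.
  by rewrite W_of_mx_sum ?undup_uniq ?mem_undup ?mem_head // of_mxK.
have := absC_to_mx (x - X s) i j; rewrite Xx to_mxB.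
move: aX; move: (to_mx x v) (to_mx (X s) v) => M N aX; rewrite 2!mxE aX => h.
apply/eqP; rewrite -subr_eq0; apply/eqP/ComplexField.Normc.eq0_normc/eqP.
by rewrite eq_le h; exact: absC_ge0.
Qed.

Lemma to_mx_topological_star_iso : topological_star_iso star p to_mx.
Proof.
split; first exact: to_mx_star_hom.
split; first exact: to_mx_continuous.
have [psi hpsi] := choice to_mx_surj.
exists psi; split.
- by move=> x; apply: to_mx_inj => v; rewrite hpsi.
- by move=> a; apply: functional_extensionality_dep => v; rewrite hpsi.
move=> a F d d0; pose G := flatten (map sl F).
pose N (s : seq I) : R := \sum_(v <- s) (n v ^ 2)%:R.
have N0 s : 0 <= N s by apply: sumr_ge0.
have c0 : 0 < 1 + N G by rewrite ltr_wpDr.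
(* A block contributes at most n_v^2 times its entry bound, so [N G] bounds the total factor; the
   summand 1 keeps the denominator positive. *)
have dc0 := divr_gt0 d0 c0; exists G, (d / (1 + N G)); split=> // b cl l lF.
have NG : N (sl l) <= N G /\ {subset sl l <= G}.
  rewrite /G; elim: F lF {G c0 dc0 cl} => [//|l' F IH] /= [->|/IH[h1 h2]]; rewrite /N big_cat /=.
    by rewrite lerDl N0; split=> // v vl; rewrite mem_cat vl.
  by rewrite ler_wpDl ?N0 //; split=> // v /h2; rewrite mem_cat orbC => ->.
set x := psi a - psi b; pose S := (\sum_(v <- sl l) W v) * x.
have : p l x <= p l S.
  by rewrite -[x](subrK S) (le_trans (snD (hp l) _ _)) // sn_sub_sl add0r.
move=> /le_lt_trans; apply.
have : p l S <= N (sl l) * (d / (1 + N G)).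
  rewrite /S mulr_suml (le_trans (sn_sum (hp l) _ _ _)) // /N mulr_suml.
  rewrite big_seq [leRHS]big_seq; apply: ler_sum => v vs.
  rewrite -of_to_mx; apply: sn_of_mx => i j.
  rewrite to_mxB !hpsi 2!mxE ltW // cl //; apply/In_mem; exact: NG.2.
move=> /le_lt_trans; apply.
rewrite (le_lt_trans (ler_wpM2r (ltW dc0) NG.1)) //.
by rewrite mulrA ltr_pdivrMr // mulrC ltr_pM2l // ltrDr.
Qed.

End MatrixUnits.

(** * Decomposition of an annihilator algebra *)

Section Structure.
Variables (R : realType) (A : algType R[i]) (L : Type).
Variables (star : A -> A) (p : L -> A -> R).
Hypothesis hA : locally_Cstar_algebra star p.
Hypothesis hann : forall J, left_ideal J -> sn_closed p J -> ran J = [set 0] -> J = setT.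
Let hs := lc_star hA.
Let hp := lc_sn hA.
Local Notation proj := (is_proj star).
Local Notation minimal_proj := (minimal_proj star).

Definition central_proj (w : A) : Prop := proj w /\ forall a, w * a = a * w.
Definition minimal_central := minimal_in central_proj.

Lemma central_projB e f : central_proj e -> central_proj f -> f * e = f ->
  central_proj (e - f).
Proof.
move=> [pe ce] [pf cf] fe; split; first exact: (projB hA).
by move=> a; rewrite mulrBl mulrBr ce cf.
Qed.

Lemma central_projM e f : central_proj e -> central_proj f -> central_proj (e * f).
Proof.
move=> [[se ee] ce] [[sf ff] cf]; split; first split.
- by rewrite (starM hs) se sf cf.
- by rewrite mulrA -(mulrA e) -ce mulrA ee -mulrA ff.
- by move=> a; rewrite -mulrA cf mulrA ce mulrA.
Qed.

Lemma minimal_central_orth w w' : minimal_central w -> minimal_central w' ->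
  w <> w' -> w * w' = 0.
Proof.
move=> [cw _ mw] [cw' _ mw'] ww'; have cp := central_projM cw cw'.
have le1 : w * w' * w = w * w' by rewrite -mulrA -cw.2 mulrA cw.1.2.
have le2 : w * w' * w' = w * w' by rewrite -mulrA cw'.1.2.
have [//|h1] := mw _ cp le1; have [//|h2] := mw' _ cp le2.
by case: ww'; rewrite -h1.
Qed.

(** Take [l] with p l w nonzero and the support [z] of [p l]. By minimality w z is 0 or w; it is not
    0, since p l (1 - z) = 0 would then give p l w = 0. So w lies below z, where [p l] is a norm. *)
Lemma minimal_central_sn w : minimal_central w ->
  exists l, forall x, x * w = x -> p l x = 0 -> x = 0.
Proof.
move=> [[[sw ww] cw] w0 mw].
have [l w1] : exists l, p l w <> 0.
  by apply: contrapT => /forallNP h; apply: w0; apply: (lc_eq0 hA) => l; have := h l => /contrapT.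
have [z [pz cz z1 nz]] := sn_support hA hann l; exists l => x xw.
have le : w * z * w = w * z by rewrite -mulrA -cw mulrA ww.
have [wz0|wz] := mw _ (central_projM (conj (conj sw ww) cw) (conj pz cz)) le.
- case: w1; apply/eqP; rewrite eq_le (sn_ge0 (hp l)) andbT.
  have {1}-> : w = w * (1 - z) by rewrite mulrBr mulr1 wz0 subr0.
  by rewrite (le_trans (snM (hp l) _ _)) // z1 mulr0.
- by apply: nz; rewrite -xw -mulrA wz.
Qed.

(* The self-adjoint x = u + u^* satisfies x^2 = -(e + f), hence x = -i (e + f), which is not
   self-adjoint. *)
Lemma minimal_proj_no_neg e f u : proj e -> proj f -> e <> 0 -> f * e = 0 ->
  f * u = u -> u * e = u -> star u * u = - e -> u * star u = - f -> False.
Proof.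
move=> [se ee] [sf ff] e0 fe fu ue uu uu'; apply: e0.
have ef : e * f = 0 by rewrite -se -sf -(starM hs) fe (star0 hs).
have eus : e * star u = star u by rewrite -{2}ue (starM hs) se.
have usf : star u * f = star u by rewrite -{2}fu (starM hs) sf.
have eu : e * u = 0 by rewrite -fu mulrA ef mul0r.
have u2 : u * u = 0 by rewrite -{1}ue -mulrA eu mulr0.
have us2 : star u * star u = 0 by rewrite -(starM hs) u2 (star0 hs).
have use : star u * e = 0 by rewrite -usf -mulrA fe mulr0.
have fus : f * star u = 0 by rewrite -eus mulrA fe mul0r.
have uf : u * f = 0 by rewrite -ue -mulrA ef mulr0.
pose g := e + f; pose x := u + star u.
have sx : star x = x by rewrite (starD hs) (starK hs) addrC.
have sg : star g = g by rewrite (starD hs) se sf.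
have gg : g * g = g by rewrite mulrDl !mulrDr ee ef fe ff addr0 add0r.
have xx : x * x = - g by rewrite mulrDl !mulrDr u2 us2 uu uu' add0r addr0 opprD addrC.
have xg : x * g = x by rewrite mulrDl !mulrDr ue uf use usf addr0 add0r.
have gx : g * x = x by rewrite -sg -sx -(starM hs) xg sx.
have eg : e * g = e by rewrite mulrDr ee ef addr0.
clearbody x g.
have si : conjc ('i%C : R[i]) = - 'i%C.
  by apply/eqP; rewrite eq_complex /= oppr0 !eqxx.
have y0 : x + 'i%C *: g = 0.
  apply: (lc_star_mul_eq0 hA).
  rewrite (starD hs) (starZ hs) sx sg si mulrDl !mulrDr xx -!scalerAr -!scalerAl xg gx gg.
  rewrite scalerA mulrN -expr2 sqr_i opprK scale1r scaleNr.
  by rewrite addrA addrK addNr.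
have x0 : x = 0.
  have h1 : x = - ('i%C *: g) by apply/eqP; rewrite -addr_eq0 y0.
  have h2 : x = 'i%C *: g.
    by rewrite -sx h1 (starN hs) (starZ hs) sg si scaleNr opprK.
  have : x *+ 2 = 0 by rewrite mulr2n {1}h1 h2 addNr.
  by rewrite -scaler_nat => /eqP; rewrite scaler_eq0 pnatr_eq0 => /eqP.
have g0 : g = 0 by rewrite -gg; apply/eqP; rewrite -oppr_eq0 gg -xx x0 mul0r.
by rewrite -eg g0 mulr0.
Qed.

(** For v = f x e the corners give v^* v = t e with t real and v v^* = c f; comparing the two values
    of v v^* v yields c = t. Dividing by the root of |t| leaves only the sign, and a negative one is
    excluded by [minimal_proj_no_neg]. *)
Lemma minimal_proj_partial_isom e f x : minimal_proj e -> minimal_proj f -> f * e = 0 ->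
  f * x * e <> 0 -> exists u, [/\ f * u = u, u * e = u & star u * u = e].
Proof.
move=> me mf fe; set v := f * x * e => v0.
have [[se ee] e0 _] := me; have [[sf ff] f0 _] := mf.
have fv : f * v = v by rewrite /v !mulrA ff.
have ve : v * e = v by rewrite /v -!mulrA ee.
have [l e1] := minimal_proj_sn hA me.
have [t vv] : exists t : R, star v * v = t%:C *: e.
  apply: (minimal_proj_sa hA hann me); first by rewrite (starM hs) (starK hs).
  by rewrite -mulrA ve.
have [c vvs] := minimal_proj_corner hA hann (v * star v) mf.
have {}vvs : v * star v = c *: f.
  by rewrite -vvs mulrA fv -mulrA -[X in star v * X]sf -(starM hs) fv.
have vE : c *: v = t%:C *: v.
  by rewrite -{1}fv scalerAl -vvs -mulrA vv -scalerAr ve.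
have cE : c = t%:C.
  apply/eqP; rewrite -subr_eq0; apply/eqP; have := congr1 (fun z => z - t%:C *: v) vE.
  by rewrite subrr -scalerBl => /eqP; rewrite scaler_eq0 => /orP[/eqP//|/eqP].
have t0 : t != 0.
  apply/eqP => t0; apply: v0; apply: (lc_star_mul_eq0 hA).
  by rewrite vv t0 scale0r.
pose r := (Num.sqrt `|t|)^-1; pose u := r%:C *: v.
have fu : f * u = u by rewrite -scalerAr fv.
have ue : u * e = u by rewrite -scalerAl ve.
have r2 : r * r * t = Num.sg t.
  rewrite -expr2 exprVn sqr_sqrtr // {2}[t]numEsg mulrCA mulVf ?mulr1 //.
  by rewrite normr_eq0.
have uu : star u * u = (Num.sg t)%:C *: e.
  by rewrite (starZr hs) -scalerAr -scalerAl vv !scalerA -!rmorphM /= r2.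
have uus : u * star u = (Num.sg t)%:C *: f.
  by rewrite (starZr hs) -scalerAr -scalerAl vvs cE !scalerA -!rmorphM /= r2.
exists u; split=> //; rewrite uu; case: (sgrP t) t0 => [_|tp|tn] // _.
  by rewrite rmorph1 scale1r.
case: (@minimal_proj_no_neg e f u) => //.
  by rewrite uu ltr0_sg // rmorphN1 scaleN1r.
by rewrite uus ltr0_sg // rmorphN1 scaleN1r.
Qed.

(* The two-sided ideal of the x with x A e = 0 is generated by a central projection. *)
Lemma minimal_proj_connected w e f : minimal_central w -> minimal_proj e ->
  minimal_proj f -> e * w = e -> f * w = f -> exists x, f * x * e <> 0.
Proof.
move=> [cw _ mw] [pe e0 _] [_ f0 _] ew fw; apply: contrapT => /forallNP fxe.
pose J : set A := [set x | forall a, x * a * e = 0].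
have idJ : left_ideal J.
  split.
  - by move=> a; rewrite !mul0r.
  - by move=> x y hx hy a; rewrite !mulrDl hx hy addr0.
  - by move=> c x hx a; rewrite -!scalerAl hx scaler0.
  - by move=> b x hx a; rewrite -!mulrA mulrA -(mulrA b) mulrA -mulrA (mulrA x) hx mulr0.
have [|c [pc cc Jc adc]] := ideal_central_proj hA hann idJ.
  by move=> a x hx b; rewrite -(mulrA x) hx.
have fc : f * c = f by apply: Jc => a; apply: contrapT; exact: fxe.
have ce : c * e = 0.
  by apply: (adherent_ann hA adc) => x hx; rewrite -[x]mulr1 hx.
have le : c * w * w = c * w by rewrite -mulrA cw.1.2.
have [cw0|cw1] := mw _ (central_projM (conj pc cc) cw) le.
  by apply: f0; rewrite -fw -fc -mulrA cw0 mulr0.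
by apply: e0; rewrite -ew -cw1 mulrA -cc ce mul0r.
Qed.

Record matrix_units (w : A) (n : nat) (e : A) (u : 'I_n -> A) (l : L) : Prop := {
  mu_pos : (0 < n)%N;
  mu_min : minimal_proj e;
  mu_sn : p l e = 1;
  mu_e : forall i, u i * e = u i;
  mu_orth : forall i j, star (u i) * u j = if i == j then e else 0;
  mu_sum : \sum_(i < n) u i * star (u i) = w }.

(** Split [w] into minimal projections f_i and join each to the first one, [e], by a partial
    isometry u_i. Then u_i u_i^* = f_i, and these sum to [w]. *)
Lemma minimal_central_units w : minimal_central w ->
  exists n e (u : 'I_n -> A) l, matrix_units w e u l.
Proof.
move=> mw; have [[pw cw] w0 _] := mw.
have [l nl] := minimal_central_sn mw.
have [s ds] := @orth_decomp_exists _ _ _ _ _ hA hann proj l w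
  (fun _ h => h) (@projB _ _ _ _ _ hA) nl pw.
have [ms ps sums] := ds.
pose f (i : 'I_(size s)) := nth 0 s i.
have fs i : f i \in s by apply: mem_nth.
have mf i : minimal_proj (f i) by apply: ms.
have fw i : f i * w = f i by apply: (orth_decomp_absorb hA (fun _ h => h) ds).
have pf i : proj (f i) by have [] := mf i.
have fo i j : i != j -> f i * f j = 0.
  (* [pairwise] gives orthogonality only in list order; the opposite order follows by adjoints. *)
  move=> ij; wlog lij : i j ij / (i < j)%N.
    move=> wl; have [lt|gt|/val_inj eq] := ltngtP i j; first exact: wl.
      by apply: (proj_orth_sym hA) => //; apply: wl; rewrite // eq_sym.
    by rewrite eq eqxx in ij.
  by move/(pairwiseP 0): ps => /(_ i j) /= h; apply/eqP/h; rewrite ?inE.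
have s0 : (0 < size s)%N.
  by rewrite lt0n; apply/eqP => s0; apply: w0; rewrite -sums (size0nil s0) big_nil.
pose i0 := Ordinal s0; pose e := f i0.
have [k e1] := minimal_proj_sn hA (mf i0).
have ex i : exists u, [/\ f i * u = u, u * e = u & star u * u = e].
  have [->|ii0] := eqVneq i i0.
    by exists e; rewrite (pf i0).2 (pf i0).1 (pf i0).2.
  have [x fx] := minimal_proj_connected mw (mf i0) (mf i) (fw i0) (fw i).
  exact: minimal_proj_partial_isom (mf i0) (mf i) (fo _ _ ii0) fx.
have [u hu] := choice ex.
exists (size s), e, u, k; split=> // [|i|i j|].
- exact: mf.
- by have [] := hu i.
- have [fi _ ui] := hu i; have [fj _ _] := hu j; case: eqP => [<-//|/eqP ij].
  by rewrite -fi -fj (starM hs) (pf i).1 mulrA -(mulrA (star (u i))) fo // mulr0 mul0r.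
rewrite -sums (big_nth 0) big_mkord; apply: eq_bigr => i _.
have [fi ui uu] := hu i.
have [c hc] := minimal_proj_corner hA hann (u i * star (u i)) (mf i).
have {}hc : u i * star (u i) = c *: f i.
  by rewrite -hc mulrA fi -mulrA -[X in star (u i) * X](pf i).1 -(starM hs) fi.
(* Evaluating u_i u_i^* u_i in two ways forces c = 1, as u_i is nonzero. *)
have : c *: u i = 1 *: u i by rewrite -{1}fi scalerAl -hc -mulrA uu ui scale1r.
move=> /eqP; rewrite -subr_eq0 -scalerBl scaler_eq0 subr_eq0 => /orP[/eqP c1|/eqP u0].
  by rewrite hc c1 scale1r.
by have [_ e0 _] := mf i0; case: e0; rewrite -/e -uu u0 mulr0.
Qed.

(** The factors are indexed by all minimal central projections. Decomposing the support of [p l]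
    gives the finitely many blocks that [p l] sees. *)
Lemma annihilator_iso : exists (I : Type) (n : I -> nat) (phi : A -> mxprod R n),
  (forall v, (0 < n v)%N) /\ topological_star_iso star p phi.
Proof.
pose I := {w : A | `[< minimal_central w >]}.
have mI (v : I) : minimal_central (val v) by apply/asboolP/(valP v).
have ex (v : I) : exists d : {n : nat & (A * ('I_n -> A) * L)%type},
    matrix_units (val v) (projT2 d).1.1 (projT2 d).1.2 (projT2 d).2.
  by have [n [e [u [l h]]]] := minimal_central_units (mI v); exists (existT _ n (e, u, l)).
have [d hd] := choice ex.
have exs l : exists s : seq I, p l (1 - \sum_(v <- s) val v) = 0.
  have [z [pz cz z1 nz]] := sn_support hA hann l.
  have [s [ms _ sz]] := @orth_decomp_exists _ _ _ _ _ hA hann central_proj l z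
    (fun _ => @proj1 _ _) central_projB nz (conj pz cz).
  (* Every entry of [s] is a minimal central projection, so [insub] discards none. *)
  exists (pmap insub s); rewrite -z1 -sz; congr (p l (1 - _)).
  elim: s ms {sz} => [|w s IH] ms; first by rewrite !big_nil.
  have mw : minimal_central w by apply: ms; rewrite mem_head.
  rewrite big_cons /=; have {}mw : `[< minimal_central w >] by apply/asboolP.
  rewrite (insubT (fun w => `[< minimal_central w >]) mw) /= big_cons IH //= => e es.
  by apply: ms; rewrite inE es orbT.
have [sl hsl] := choice exs.
pose u (v : I) := (projT2 (d v)).1.2.
exists I, (fun v => projT1 (d v)).
pose e (v : I) := (projT2 (d v)).1.1.
have corner v x : exists c : R[i], e v * x * e v = c *: e v.
  exact: (minimal_proj_corner hA hann x (mu_min (hd v))).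
exists (@to_mx _ _ star I e _ u corner); split.
  by move=> v; exact: mu_pos (hd v).
apply: (@to_mx_topological_star_iso _ _ _ _ _ hA I val _ _ u
  (fun v => (projT2 (d v)).2) sl) => //.
- by move=> v; have [[]] := mI v.
- move=> v v' vv'; apply: minimal_central_orth => // h; apply: vv'; exact: val_inj.
- by move=> v; have [] := mu_min (hd v).
- by move=> v; exact: mu_sn (hd v).
- by move=> v; exact: mu_e (hd v).
- by move=> v; exact: mu_orth (hd v).
- by move=> v; exact: mu_sum (hd v).
Qed.

End Structure.

(** * Closed ideals in products of matrix algebras *)

Section MatrixProduct.
Variables (R : realType) (A : algType R[i]) (L : Type).
Variables (star : A -> A) (p : L -> A -> R).
Hypothesis hA : locally_Cstar_algebra star p.
Let hs := lc_star hA.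
Let hp := lc_sn hA.

Lemma setT_ran S : S = setT -> ran S = [set 0] :> set A.
Proof.
move=> ->; apply/seteqP; split=> x /=; last by move=> -> s _; rewrite mulr0.
by move/(_ 1 I); rewrite mul1r.
Qed.

(** The involution preserves every seminorm and exchanges closed right ideals with closed left
    ideals, and left with right annihilators. *)
Lemma annihilator_of_left :
  (forall J, left_ideal J -> sn_closed p J -> ran J = [set 0] -> J = setT) ->
  annihilator_algebra p.
Proof.
move=> hann; split=> J idJ clJ; first by split=> [/(hann J idJ clJ)|/setT_ran].
split=> [lJ|->]; last first.
  apply/seteqP; split=> x /=; last by move=> -> s _; rewrite mul0r.
  by move/(_ 1 I); rewrite mulr1.
have [J0 JD JZ JM] := idJ.
suff h : [set x | J (star x)] = setT.
  apply/seteqP; split=> // x _; rewrite -(starK hs x).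
  by have : [set x | J (star x)] (star x) by rewrite h.
apply: hann.
- split=> /=; first by rewrite (star0 hs).
  + by move=> x y hx hy; rewrite (starD hs); apply: JD.
  + by move=> c x hx; rewrite (starZ hs); apply: JZ.
  + by move=> a x hx; rewrite (starM hs); apply: JM.
- move=> x hx; apply: clJ => F d d0; have [s [Js cl]] := hx F d d0.
  exists (star s); split=> // l lF.
  by rewrite -(starB hs) (sn_star hs (hp l)); apply: cl.
apply/seteqP; split=> x /=; last by move=> -> s _; rewrite mulr0.
move=> hx; have : lan J (star x).
  move=> s Js; rewrite -[s](starK hs) -(starM hs) hx ?(star0 hs) //=.
  by rewrite (starK hs).
by rewrite lJ /= => h; rewrite -[x](starK hs) h (star0 hs).
Qed.

Variables (I : Type) (n : I -> nat) (phi : A -> mxprod R n).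
Hypothesis iso : topological_star_iso star p phi.

Lemma mxprod_single v (M : 'M[R[i]]_(n v)) :
  exists b : mxprod R n, b v = M /\ forall w, w <> v -> b w = 0.
Proof.
(* Equality of indices is decided classically and [M] is transported along it, because the matrix
   size depends on the index. *)
exists (fun w => match pselect (v = w) with
  | left E => eq_rect v (fun w => 'M_(n w)) M w E | right _ => 0 end).
split=> [|w wv]; case: pselect => // E; last by case: wv.
by rewrite (Prop_irrelevance E erefl).
Qed.

Lemma iso_surj (b : mxprod R n) : exists x, phi x = b.
Proof. by have [_ [_ [psi [_ h _]]]] := iso; exists (psi b). Qed.

Lemma iso_inj x y : (forall v, phi x v = phi y v) -> x = y.
Proof.
have [_ [_ [psi [h _ _]]]] := iso => e; rewrite -(h x) -(h y); congr psi.
exact: functional_extensionality_dep e.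
Qed.

Lemma iso0 v : phi 0 v = 0.
Proof.
have [[hD _ _ _ _] _] := iso.
by apply: (addrI (phi 0 v)); rewrite -hD !addr0.
Qed.

(** Choose s in [J] whose component at [v] has maximal rank. If the rank is not full, the cokernel
    matrix placed at [v] is a nonzero z with s z = 0 in that component; some t in [J] has t z
    nonzero, so adding its row space increases the rank. *)
Lemma left_ideal_mx_full J v : left_ideal J -> ran J = [set 0] ->
  exists s, J s /\ phi s v = 1%:M.
Proof.
move=> [J0 JD JZ JM] rJ; have [[hD hZ hM h1 _] _] := iso.
pose P k := `[< exists s, J s /\ \rank (phi s v) = k >].
have exP : exists k, P k by exists (\rank (phi 0 v)); apply/asboolP; exists 0.
have leP k : P k -> (k <= n v)%N by move=> /asboolP[s [_ <-]]; exact: rank_leq_row.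
have [k /asboolP[s [Js sk]] maxk] := ex_maxnP exP leP.
(* Left multiplication realises row combinations: a matrix with rows in the sum of the two row
   spaces is the component of an element of [J]. *)
have lift (M N : 'M_(n v)) t : J t -> (M <= N + phi t v)%MS ->
    (N <= phi s v)%MS -> exists r, J r /\ phi r v = M.
  move=> Jt /sub_addsmxP[[B C] /= ->] /submxP[D ->].
  have [b [bv _]] := mxprod_single (B *m D); have [x xb] := iso_surj b.
  have [c [cv _]] := mxprod_single C; have [y yc] := iso_surj c.
  exists (x * s + y * t); split; first by apply: JD; apply: JM.
  by rewrite hD !hM xb yc bv cv mulmxA.
suff full : row_full (phi s v).
  have [|r [Jr rv]] := lift 1%:M (phi s v) s Js _ (submx_refl _); last by exists r.
  by rewrite (submx_trans (submx_full _ full)) // addsmxSl.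
rewrite -[row_full _]negbK; apply/negP => nfull.
have ck0 : cokermx (phi s v) != 0.
  by rewrite -mxrank_eq0 mxrank_coker subn_eq0 -ltnNge ltn_neqAle nfull rank_leq_col.
have [b [bv b0]] := mxprod_single (cokermx (phi s v)).
have [z zb] := iso_surj b.
have z0 : z <> 0 by move=> z0; move: ck0; rewrite -bv -zb z0 iso0 eqxx.
have [t [Jt tz]] : exists t, J t /\ t * z <> 0.
  apply: contrapT => /forallNP h; apply: z0.
  suff : ran J z by rewrite rJ.
  by move=> t Jt; apply: contrapT => tz; apply: (h t).
have nsub : ~~ (phi t v <= phi s v)%MS.
  rewrite submxE; apply/negP => /eqP tc; apply: tz; apply: iso_inj => w.
  rewrite hM iso0 zb; have [->|wv] := pselect (w = v); first by rewrite bv.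
  by rewrite b0 // mulmx0.
have [|r [Jr rv]] := lift (phi s v + phi t v)%MS (phi s v) t Jt _ (submx_refl _).
  exact: submx_refl.
have := maxk (\rank (phi r v)); rewrite leqNgt => /(_ _)/negP; apply.
  by apply/asboolP; exists r.
rewrite rv -sk; apply: rank_ltmx; rewrite ltmxE addsmxSl addsmx_sub submx_refl.
exact: nsub.
Qed.

(** A neighbourhood in the product constrains finitely many factors, and there an element of [J] can
    match [x] exactly; closedness then puts [x] in [J]. *)
Lemma iso_left_annihilator J : left_ideal J -> sn_closed p J ->
  ran J = [set 0] -> J = setT.
Proof.
move=> idJ clJ rJ; have [J0 JD JZ JM] := idJ.
have [[hD hZ hM h1 _] [_ [psi [phiK psiK psiC]]]] := iso.
apply/seteqP; split=> // x _; apply: clJ => F d d0.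
have [G [d' [d'0 hG]]] := psiC (phi x) F d d0.
have [s [Js sx]] : exists s, J s /\ forall v, List.In v G -> phi s v = phi x v.
  elim: G {hG} => [|v G [s [Js sx]]]; first by exists 0.
  have [t [Jt tv]] := left_ideal_mx_full v idJ rJ.
  (* The correction is supported at [v] alone, so components already matched are kept. *)
  have [b [bv b0]] := mxprod_single (phi x v - phi s v); have [y yb] := iso_surj b.
  exists (s + y * t); split; first by apply: JD => //; apply: JM.
  move=> w wG; rewrite hD hM yb; have [->|wv] := pselect (w = v).
    by rewrite bv tv mulmx1 addrC subrK.
  by rewrite b0 // mul0mx addr0; case: wG => [/esym//|]; exact: sx.
exists s; split=> //; rewrite -(phiK x) -(phiK s); apply: hG => v vG j k.
by rewrite sx // subrr -[0]/(0%:C) absC_real normr0.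
Qed.

End MatrixProduct.

Theorem theorem3p29 (R : realType) (A : algType R[i]) (L : Type)
    (star : A -> A) (p : L -> A -> R) :
  locally_Cstar_algebra star p ->
  (annihilator_algebra p <->
   exists (I : Type) (n : I -> nat) (phi : A -> mxprod R n),
     (forall v, (0 < n v)%N) /\ topological_star_iso star p phi).
Proof.
move=> hA; split=> [[hann _]|[I [n [phi [_ iso]]]]].
  by apply: annihilator_iso => // J idJ clJ; exact: (hann J idJ clJ).1.
apply: (annihilator_of_left hA) => J; exact: (iso_left_annihilator iso).
Qed.
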